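(* Let $l>0$ be real and let $s\ge 1$, $n\ge 1$, $d\ge 2$ be integers. Let $L$ be either $C(I^s)$ with $\|\cdot\|=\|\cdot\|_\infty$, or $L^1(I^s)$ with $\|\cdot\|=\|\cdot\|_{L^1}$. For every family $(c_k)_{k\in\mathbb{N}^n,\,|k|\le d}$ of elements of $L$, put $$P(\zeta)=\sum_{|k|\le d}c_k\,\zeta^k\in L,\qquad \zeta=(\zeta_1,\ldots,\zeta_n)\in\mathbb{R}^n .$$ Then there exists $h\in\Lambda_{l,s}$ such that for all $\zeta\in\mathbb{R}^n$, $$\|h-P(\zeta)\|\ \ge\ \frac{C(l,s)}{(n\log d)^{l/s}} .$$ Equivalently, denoting by $\mathcal{P}_{n,d}$ the set of all such maps $P$, $$D_{n,d}(\Lambda_{l,s}):=\inf_{P\in\mathcal{P}_{n,d}}\ \sup_{h\in\Lambda_{l,s}}\ \inf_{\zeta\in\mathbb{R}^n}\|h-P(\zeta)\|\ \ge\ \frac{C(l,s)}{(n\log d)^{l/s}} .$$ Here one can take, when $L=C(I^s)$, $C(l,s)=C_\infty(l,s)$, and when $L=L^1(I^s)$, $C(l,s)=C_{L^1}(l,s)$, where $$C_{\infty}(l,s)=\frac{1}{\sqrt{s}\,2^{l+1}\,8^{l/s}\,([l]+1)^{[l]+1}\,(4(1+e))^{s([l]+1)}},$$ $$C_{L^1}(l,s)=\frac{(([l]+1)!)^{2s}}{5\sqrt{s}\,2^{l+2}\,18^{l/s}\,([l]+1)^{[l]+1}\,((2[l]+3)!)^s\,(1+e)^{s([l]+1)}}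 .$$
   Context: $I=[0,1]$; $[l]$ is the integer part of $l$; $\log$ is the base-2 logarithm; for $k\in\mathbb{N}^n$, $|k|=k_1+\cdots+k_n$ and $\zeta^k=\zeta_1^{k_1}\cdots\zeta_n^{k_n}$. Functions are real-valued. Write $l=m+\alpha$ with $m\in\mathbb{N}$ and $0<\alpha\le 1$ (so $m=\lceil l\rceil-1$). $\Lambda_{l,s}=\Lambda_l(I^s)$ is the set of real functions $f$ of class $C^m$ on $I^s$ such that every partial derivative of $f$ of order $\le m$ has sup norm $\le 1$ on $I^s$, and every partial derivative $g$ of order $m$ satisfies $\|g\|_\alpha:=\sup_{x\ne y}\frac{|g(x)-g(y)|}{\|x-y\|^\alpha}\le 1$, where $\|\cdot\|$ is the Euclidean norm on $\mathbb{R}^s$. *)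

(* Defs.v *)
From HB Require Import structures.
From mathcomp Require Import all_boot all_order all_algebra.
From mathcomp Require Import all_classical all_reals all_analysis.

Set Implicit Arguments.
Unset Strict Implicit.
Unset Printing Implicit Defensive.

Import Order.TTheory GRing.Theory Num.Theory.
Import numFieldNormedType.Exports.

Local Open Scope classical_set_scope.
Local Open Scope ring_scope.

Definition cube (R : realType) (s : nat) : set 'rV[R]_s :=
  [set x | forall i, 0 <= x 0 i <= 1].

(* The norm [`|x|] that the library puts on row vectors is the maximum norm. *)
Definition eucl_norm (R : realType) (s : nat) (x : 'rV[R]_s) : R :=
  Num.sqrt (\sum_i x 0 i ^+ 2).

Definition diff_quot (R : realType) (s : nat) (i : 'I_s) (f : 'rV[R]_s -> R)
    (x : 'rV[R]_s) (t : R) : R :=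
  t^-1 * (f (x + t *: 'e_i) - f x).

(* The nonzero increments [t] along the [i]-th axis that stay in the cube: on
   the faces of the cube the partial derivatives are one-sided. *)
Definition cube_incr (R : realType) (s : nat) (i : 'I_s) (x : 'rV[R]_s) :
    set_system R :=
  within [set t | cube (x + t *: 'e_i)] 0^'.

Definition cube_derivable (R : realType) (s : nat) (i : 'I_s)
    (f : 'rV[R]_s -> R) (x : 'rV[R]_s) : Prop :=
  cvg (diff_quot i f x t @[t --> cube_incr i x]).

(* Meaningful only at those points [x] of the cube where
   [cube_derivable i f x] holds. *)
Definition cube_partial (R : realType) (s : nat) (i : 'I_s)
    (f : 'rV[R]_s -> R) : 'rV[R]_s -> R :=
  fun x => lim (diff_quot i f x t @[t --> cube_incr i x]).

(* A partial derivative of order [p] is given by a word of length [p] in the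
   coordinates. *)
Definition cube_partials (R : realType) (s : nat) (w : seq 'I_s)
    (f : 'rV[R]_s -> R) : 'rV[R]_s -> R :=
  foldr (@cube_partial R s) f w.

Definition cube_Cm (R : realType) (s m : nat) (f : 'rV[R]_s -> R) : Prop :=
  (forall w : seq 'I_s, (size w < m)%N ->
     forall (i : 'I_s) (x : 'rV[R]_s), cube x ->
       cube_derivable i (cube_partials w f) x) /\
  (forall w : seq 'I_s, (size w <= m)%N ->
     {within @cube R s, continuous (cube_partials w f)}).

Definition sup_norm (R : realType) (s : nat) (f : 'rV[R]_s -> R) : \bar R :=
  ereal_sup [set `|f x|%:E | x in @cube R s].

Definition holder_seminorm (R : realType) (s : nat) (alpha : R)
    (g : 'rV[R]_s -> R) : \bar R :=
  ereal_sup [set q | exists x y : 'rV[R]_s, [/\ cube x, cube y, x <> y &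
    q = (`|g x - g y| / eucl_norm (x - y) `^ alpha)%:E]].

(* For [0 < l], [l = m + alpha] with [m] a natural number and
   [0 < alpha <= 1]. *)
Definition smooth_order (R : realType) (l : R) : nat := (`|Num.ceil l|%N).-1.

Definition Lambda (R : realType) (l : R) (s : nat) : set ('rV[R]_s -> R) :=
  let m := smooth_order l in
  let alpha := l - m%:R in
  [set f | [/\ cube_Cm m f,
    (forall w : seq 'I_s, (size w <= m)%N ->
       (sup_norm (cube_partials w f) <= 1)%E) &
    (forall w : seq 'I_s, size w = m ->
       (holder_seminorm alpha (cube_partials w f) <= 1)%E)]].
Arguments Lambda {R} l s _ : assert.

Section lebesgue_measure_tuple.
Context {R : realType}.
Local Notation RT := (measurableTypeR R).

Definition tcons (n : nat) (p : RT * n.-tuple RT) :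
    n.+1.-tuple RT :=
  [tuple of p.1 :: p.2].

Lemma measurable_tcons n : measurable_fun setT (@tcons n).
Proof. exact: (measurable_cons measurable_fst measurable_snd). Qed.

Section lebS.
Context (n : nat) (mu : {sigma_finite_measure set (n.-tuple RT) -> \bar R}).

(* The product of Lebesgue measure and [mu], carried to [n.+1]-tuples. *)
Definition lebS := pushforward (@lebesgue_measure R \x mu)%E (@tcons n).

Let lebS0 : lebS set0 = 0%E.
Proof. by rewrite /lebS /pushforward preimage_set0 measure0. Qed.

Let lebS_ge0 A : (0 <= lebS A)%E.
Proof. by rewrite /lebS /pushforward; apply: measure_ge0. Qed.

Let lebS_sigma_additive : semi_sigma_additive lebS.
Proof.
move=> F mF tF mUF; rewrite /lebS /pushforward preimage_bigcup.
apply: measure_semi_sigma_additive.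
- by move=> k; rewrite -[X in measurable X]setTI; exact: measurable_tcons.
- apply/trivIsetP => /= i j _ _ ij; rewrite -preimage_setI.
  by move/trivIsetP : tF => /(_ _ _ _ _ ij) ->//; rewrite preimage_set0.
- rewrite -preimage_bigcup -[X in measurable X]setTI.
  exact: measurable_tcons.
Qed.

HB.instance Definition _ :=
  isMeasure.Build _ _ _ lebS lebS0 lebS_ge0 lebS_sigma_additive.

Let lebS_sigma_finite : sigma_finite setT lebS.
Proof.
have /sigma_finiteP[F [TF ndF Foo]] := sigma_finiteT (@lebesgue_measure R).
have /sigma_finiteP[G [TG ndG Goo]] := sigma_finiteT mu.
pose u (t : n.+1.-tuple RT)  : RT * n.-tuple RT :=
  (thead t, [tuple of behead t]).
have mu' : measurable_fun setT u.
  apply/measurable_fun_pairP; split.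
    exact: measurable_tnth.
  exact: measurable_behead.
exists (fun k => u @^-1` (F k `*` G k)).
  apply/seteqP; split => // t _.
  have [[i _ Fi] [j _ Gj]] : (\bigcup_k F k) (u t).1 /\ (\bigcup_k G k) (u t).2.
    by rewrite -TF -TG.
  exists (maxn i j) => //; split.
    by move: (u t).1 Fi; exact/subsetPset/ndF/leq_maxl.
  by move: (u t).2 Gj; exact/subsetPset/ndG/leq_maxr.
move=> k; have [mF Fk] := Foo k; have [mG Gk] := Goo k; split.
  by rewrite -[X in measurable X]setTI; apply: mu' => //; exact: measurableX.
rewrite /lebS /pushforward -comp_preimage.
have -> : u \o @tcons n = id.
  by apply/funext => -[a t]; congr pair; exact/val_inj.
by rewrite preimage_id product_measure1E// lte_mul_pinfty// ge0_fin_numE.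
Qed.

HB.instance Definition _ :=
  Measure_isSigmaFinite.Build _ _ _ lebS lebS_sigma_finite.

End lebS.

Fixpoint lebesgue_tuple (n : nat) :
    {sigma_finite_measure set (n.-tuple RT) -> \bar R} :=
  if n is n'.+1 then lebS (lebesgue_tuple n') else \d_[tuple].

Lemma lebesgue_tuple_box (n : nat) (A : 'I_n -> set RT) :
  (forall i, measurable (A i)) ->
  lebesgue_tuple n [set t | forall i, A i (tnth t i)] =
  (\prod_i @lebesgue_measure R (A i))%E.
Proof.
elim: n A => [|n IH] A mA.
  rewrite big_ord0 /= diracE; suff -> : [tuple] \in
    [set t : 0.-tuple RT | forall i, A i (tnth t i)] by [].
  by rewrite inE => -[].
have mbox : measurable
    [set t : n.-tuple RT | forall i, A (lift ord0 i) (tnth t i)].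
  have -> : [set t : n.-tuple RT | forall i, A (lift ord0 i) (tnth t i)] =
      \bigcap_(i in setT) ((@tnth n RT ^~ i) @^-1` A (lift ord0 i)).
    by apply/seteqP; split => t h i; [move=> _; exact: h|exact: (h i)].
  apply: fin_bigcap_measurable => [|i _]; first exact: finite_finset.
  by rewrite -[X in measurable X]setTI; exact: measurable_tnth.
rewrite big_ord_recl -IH; last by move=> i; exact: mA.
rewrite -product_measure1E//= /lebS /pushforward; congr (product_measure1 _ _).
apply/seteqP; split => -[a t] /=.
  move=> h; split; first by have := h ord0.
  by move=> i; have := h (lift ord0 i); rewrite tnthS.
move=> [h0 h] i; case: (unliftP ord0 i) => [j ->|->] //.
by rewrite tnthS; exact: h.
Qed.

End lebesgue_measure_tuple.

Definition continuous_space (R : realType) (s : nat) : set ('rV[R]_s -> R) :=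
  [set f | {within @cube R s, continuous f}].

Arguments continuous_space R s _ : clear implicits.

Definition row_of_tuple (R : realType) (s : nat)
    (t : s.-tuple (measurableTypeR R)) : 'rV[R]_s := \row_i tnth t i.

Definition L1_space (R : realType) (s : nat) : set ('rV[R]_s -> R) :=
  [set f | (lebesgue_tuple s).-integrable
    (@row_of_tuple R s @^-1` @cube R s) (fun t => (f (row_of_tuple t))%:E)].

Arguments L1_space R s _ : clear implicits.

Definition L1_norm (R : realType) (s : nat) (f : 'rV[R]_s -> R) : \bar R :=
  (\int[lebesgue_tuple s]_(t in @row_of_tuple R s @^-1` @cube R s)
     `|f (row_of_tuple t)|%:E)%E.

(* A multi-index [k] with [|k| <= d] has all its entries at most [d]; the
   entries are therefore taken in ['I_d.+1]. *)
Definition poly_map (R : realType) (s n d : nat)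
    (c : {ffun 'I_n -> 'I_d.+1} -> 'rV[R]_s -> R) (zeta : 'rV[R]_n) :
    'rV[R]_s -> R :=
  fun x => \sum_(k : {ffun 'I_n -> 'I_d.+1} | (\sum_i k i <= d)%N)
             c k x * \prod_i zeta 0 i ^+ k i.

Definition poly_maps (R : realType) (s : nat) (L : set ('rV[R]_s -> R))
    (n d : nat) : set ('rV[R]_n -> 'rV[R]_s -> R) :=
  [set P | exists2 c : {ffun 'I_n -> 'I_d.+1} -> 'rV[R]_s -> R,
     (forall k : {ffun 'I_n -> 'I_d.+1}, (\sum_i k i <= d)%N -> L (c k)) &
     P = poly_map c].
Arguments poly_maps {R s} L n d _ : assert.

Definition poly_width (R : realType) (s : nat) (L : set ('rV[R]_s -> R))
    (nrm : ('rV[R]_s -> R) -> \bar R) (n d : nat)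
    (H : set ('rV[R]_s -> R)) : \bar R :=
  ereal_inf [set ereal_sup [set ereal_inf [set nrm (h \- P zeta)
    | zeta in [set: 'rV[R]_n]] | h in H] | P in poly_maps L n d].

Definition log2 (R : realType) (x : R) : R := ln x / ln 2.

Definition C_inf (R : realType) (l : R) (s : nat) : R :=
  let p := (Num.truncn l).+1 in
  1 / (Num.sqrt s%:R * 2 `^ (l + 1) * 8 `^ (l / s%:R) * p%:R ^+ p *
       (4 * (1 + expR 1)) ^+ (s * p)).

Definition C_L1 (R : realType) (l : R) (s : nat) : R :=
  let p := (Num.truncn l).+1 in
  (p`!)%:R ^+ (2 * s) /
  (5 * Num.sqrt s%:R * 2 `^ (l + 2) * 18 `^ (l / s%:R) * p%:R ^+ p *
   ((2 * Num.truncn l + 3)`!)%:R ^+ s * (1 + expR 1) ^+ (s * p)).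

Definition width_bound (R : realType) (C l : R) (s n d : nat) : R :=
  C / (n%:R * log2 d%:R) `^ (l / s%:R).

(* Main.v *)
Require Import Defs.
From mathcomp Require Import all_boot all_order all_algebra.
From mathcomp Require Import all_classical all_reals all_analysis.
From mathcomp Require Import measurable_realfun.
From mathcomp Require Import ring lra zify.
Set Implicit Arguments.
Unset Strict Implicit.
Unset Printing Implicit Defensive.
Import Order.TTheory GRing.Theory Num.Theory.
Import numFieldNormedType.Exports.
Local Open Scope classical_set_scope.
Local Open Scope ring_scope.

(** Cut the cube into [N = q ^ s] equal cells and let [h] be a sum of bumps, one
    in each cell, with arbitrary signs. With [p = [l] + 1], the bump is a rescaled
    product of the functions [(x (1 - x)) ^ p], whose derivatives of order
    [k < p] vanish at 0 and 1 and are at most [p ^ k]; hence all [2 ^ N] functions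
    [h], with amplitude of the order of [q ^ (- l)], are in [Lambda l s]
    ([wave_Lambda]).

    In each cell [j] take a linear functional: the value at the centre for the
    sup norm, the integral over the cell for the L1 norm. Applied to [P zeta] and
    divided by its value on the bump, it gives a polynomial [F j] of degree at
    most [d] in [zeta]. If every [h] is well approximated by some [P zeta], then
    every sign vector [sigma] is close to some vector [F (zeta sigma)]. This is
    impossible when [N] is at least [16 n log d] ([unreachable_signs]), and this
    [N] gives the bound.

    The impossibility is a dimension count, instead of a count of the connected
    components cut out by the hypersurfaces [F j = 0]. For a sign vector [tau]
    let [g tau = \prod_j (1 + tau_j F j)], a polynomial of degree at most [N d]
    in [zeta]. The vectors [(g tau zeta)_tau], for all [zeta], lie in a space of
    dimension [r] at most the number of monomials of degree at most [N d]. The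
    diagonal entries of the orthogonal projector onto that space sum to [r], and
    the entry at [tau] is at least the fraction of the squared norm of
    [(g tau zeta)_tau] that is carried by the coordinate [tau]
    ([leverage_scores]). When [F (zeta sigma)] is close to [sigma], the coordinate
    [sigma] carries a fraction much larger than [2 ^ (- N)], so that [r] grows
    exponentially with [N] ([sign_capacity]). But [r] is at most
    [(e (1 + N d / n)) ^ n] ([card_multi_indices]), which is smaller as soon as
    [N >= 16 n log d] ([few_multi_indices]).

    In the L1 norm only the mean of [|sigma_j - F j|] is small and single
    coordinates may be far off. They could make the fraction carried by [sigma]
    vanish; therefore the entries of the projector are averaged over the
    coordinates [tau] obtained from [sigma] by flipping each sign with
    probability 1/4, and the loss is then at most exponential in the sum of the
    errors ([agreement_ge]). *)

(** * Leverage scores *)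

Lemma cauchy_schwarz_sum (R : realFieldType) (I : finType) (a b : I -> R) :
  (\sum_i a i * b i) ^+ 2 <= (\sum_i a i ^+ 2) * (\sum_i b i ^+ 2).
Proof.
have sumM (u v : I -> R) : (\sum_i u i) * (\sum_j v j) = \sum_i \sum_j u i * v j.
  by rewrite mulr_suml; apply: eq_bigr => i _; rewrite mulr_sumr.
have : 0 <= \sum_i \sum_j (a i * b j - a j * b i) ^+ 2.
  by apply: sumr_ge0 => i _; apply: sumr_ge0 => j _; exact: sqr_ge0.
have -> : \sum_i \sum_j (a i * b j - a j * b i) ^+ 2 =
    ((\sum_i a i ^+ 2) * (\sum_i b i ^+ 2) - (\sum_i a i * b i) ^+ 2) *+ 2.
  rewrite mulr2n {2}[(\sum_i a i ^+ 2) * _]mulrC !expr2 !sumM -!sumrB -big_split.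
  apply: eq_bigr => i _ /=; rewrite -!sumrB -big_split /=.
  by apply: eq_bigr => j _; ring.
by rewrite pmulrn_lge0 // subr_ge0.
Qed.

Lemma gram_unit (R : realFieldType) (m r : nat) (B : 'M[R]_(m, r)) :
  row_full B -> B^T *m B \in unitmx.
Proof.
rewrite -row_free_unit => fB; apply: inj_row_free => v.
rewrite mulmxA => /(congr1 (mulmx^~ v^T)); rewrite mul0mx -mulmxA.
rewrite -[B *m _]trmxK trmx_mul trmxK; set w := v *m B^T => ww0.
have w0 : w = 0.
  apply/rowP => i; rewrite [RHS]mxE; apply/eqP; rewrite -sqrf_eq0.
  have := congr1 (fun A : 'M[R]_(1, 1) => A 0 0) ww0; rewrite !mxE => /eqP.
  rewrite psumr_eq0 => [/allP/(_ i)|j _]; rewrite !mxE -expr2 ?sqr_ge0 //.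
  by rewrite mem_index_enum => /(_ isT).
have fBt : row_free B^T by rewrite -row_leq_rank mxrank_tr; case/eqP: fB => ->.
by apply: (row_free_inj fBt); rewrite mul0mx.
Qed.

(** The numbers [lev i] are the leverage scores of [Y]: the diagonal entries of
    the orthogonal projector onto its column space, whose trace is the rank. *)
Lemma leverage_scores (R : realFieldType) (m r : nat) (Y : 'M[R]_(m, r)) :
  exists lev : 'I_m -> R, \sum_i lev i <= r%:R /\
    forall (z : 'cV[R]_r) i,
      (Y *m z) i 0 ^+ 2 <= lev i * \sum_k (Y *m z) k 0 ^+ 2.
Proof.
have [B fB [C YB]] : exists2 B : 'M[R]_(m, \rank Y),
    row_full B & exists C, Y = B *m C.
  exists (col_base Y); first exact: col_base_full.
  by exists (row_base Y); rewrite mulmx_base.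
have UG := gram_unit fB.
pose Pi := B *m invmx (B^T *m B) *m B^T.
have PiB : Pi *m B = B by rewrite /Pi -mulmxA -mulmxA mulVmx // mulmx1.
have PiY : Pi *m Y = Y by rewrite [in LHS]YB mulmxA PiB -YB.
have PiT : Pi^T = Pi.
  by rewrite /Pi !trmx_mul trmxK trmx_inv trmx_mul trmxK mulmxA.
have Pi2 : Pi *m Pi = Pi by rewrite {2}/Pi !mulmxA PiB.
have trPi : \tr Pi <= r%:R.
  by rewrite /Pi mxtrace_mulC mulmxA mulmxV // mxtrace1 ler_nat rank_leq_col.
move: Pi PiY PiT Pi2 trPi {PiB} => Pi PiY PiT Pi2 trPi.
exists (fun i => Pi i i); split=> [//|z i].
have -> : Pi i i = \sum_k Pi i k ^+ 2.
  rewrite -[in LHS]Pi2 mxE; apply: eq_bigr => k _.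
  by rewrite expr2 -[in X in _ * X = _]PiT mxE.
rewrite -[in X in X ^+ 2 <= _]PiY -mulmxA mxE; exact: cauchy_schwarz_sum.
Qed.

Lemma leverage_scores_fin (R : realFieldType) (T K : finType) (A : {set K})
    (a : T -> K -> R) :
  exists lev : T -> R, \sum_t lev t <= #|A|%:R /\
    forall (z : K -> R) t, (\sum_(k in A) a t k * z k) ^+ 2 <=
      lev t * \sum_u (\sum_(k in A) a u k * z k) ^+ 2.
Proof.
pose Y := \matrix_(t < #|T|, k < #|A|) a (enum_val t) (enum_val k).
have [lev [levD levY]] := leverage_scores Y.
have Yz (z : K -> R) t : (Y *m \col_k z (enum_val k)) t 0 =
    \sum_(k in A) a (enum_val t) k * z k.
  rewrite mxE [RHS]big_enum_val. by apply: eq_bigr => k _; rewrite !mxE.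
have sumT (f : T -> R) : \sum_t f t = \sum_(i < #|T|) f (enum_val i).
  by rewrite (reindex _ (onW_bij _ (@enum_val_bij T))).
exists (lev \o enum_rank); split.
  by rewrite sumT (eq_bigr lev) // => i _; rewrite /= enum_valK.
move=> z t; have := levY (\col_k z (enum_val k)) (enum_rank t).
rewrite Yz enum_rankK sumT; congr (_ <= _ * _).
by apply: eq_bigr => i _; rewrite Yz.
Qed.

(** * Polynomial functions of bounded degree *)

Section polynomial_maps.
Context {R : realType} {n : nat}.
Implicit Types (z : 'rV[R]_n) (f g : 'rV[R]_n -> R).

Definition multi_indices E := [set k : {ffun 'I_n -> 'I_E.+1} | (\sum_i k i <= E)%N]%SET.

Definition monom z (k : 'I_n -> nat) : R := \prod_i z 0 i ^+ k i.

Definition poly_le E f := exists a : {ffun 'I_n -> 'I_E.+1} -> R,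
  forall z, f z = \sum_(k in multi_indices E) a k * monom z (fun i => k i).

Lemma poly_le_eq E f g : f =1 g -> poly_le E f -> poly_le E g.
Proof. by move=> fg [a fa]; exists a => z; rewrite -fg fa. Qed.

Lemma poly_le_monom E (c : R) (k : 'I_n -> nat) :
  (\sum_i k i <= E)%N -> poly_le E (fun z => c * monom z k).
Proof.
move=> kE; have kiE i : (k i < E.+1)%N.
  by rewrite ltnS (leq_trans _ kE) // (bigD1 i) //= leq_addr.
pose k0 := [ffun i => Ordinal (kiE i)].
have k0E : k0 \in multi_indices E.
  by rewrite inE; under eq_bigr do rewrite ffunE.
exists (fun k' => c * (k' == k0)%:R) => z.
rewrite (bigD1 k0) //= eqxx mulr1 big1 ?addr0 => [|k' /andP[_ /negbTE ->]].
  by congr (_ * _); apply: eq_bigr => i _; rewrite ffunE.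
by rewrite mulr0 mul0r.
Qed.

Lemma poly_le_sum E (I : Type) (r : seq I) (P : pred I) (f : I -> 'rV[R]_n -> R) :
  (forall i, P i -> poly_le E (f i)) ->
  poly_le E (fun z => \sum_(i <- r | P i) f i z).
Proof.
move=> fE; elim: r => [|i r [a ar]].
  by exists (fun=> 0) => z; rewrite big_nil big1 // => k _; rewrite mul0r.
case: (boolP (P i)) => Pi; last first.
  by exists a => z; rewrite big_cons (negbTE Pi) ar.
have [b bi] := fE _ Pi; exists (fun k => b k + a k) => z.
rewrite big_cons Pi ar bi -big_split; apply: eq_bigr => k _.
by rewrite mulrDl.
Qed.

Lemma poly_le_mul E E' f g :
  poly_le E f -> poly_le E' g -> poly_le (E + E') (fun z => f z * g z).
Proof.
move=> [a fa] [b gb].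
apply: (@poly_le_eq _ (fun z => \sum_(k in multi_indices E) \sum_(k' in multi_indices E')
    a k * b k' * monom z (fun i => k i + k' i)%N)).
  move=> z; rewrite fa gb mulr_suml; apply: eq_bigr => k _.
  rewrite mulr_sumr; apply: eq_bigr => k' _.
  have -> : monom z (fun i => k i + k' i)%N =
      monom z (fun i => k i) * monom z (fun i => k' i).
    by rewrite /monom -big_split; apply: eq_bigr => i _; rewrite exprD.
  by ring.
apply: poly_le_sum => k; rewrite inE => kE; apply: poly_le_sum => k'.
rewrite inE => kE'; apply: poly_le_monom.
by rewrite big_split leq_add.
Qed.

Lemma poly_le_affine E (c c' : R) f :
  poly_le E f -> poly_le E (fun z => c + c' * f z).
Proof.
move=> [a fa]; apply: (@poly_le_eq _ (fun z => \sum_(b : bool)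
    if b then c * monom z (fun=> 0%N)
    else \sum_(k in multi_indices E) c' * a k * monom z (fun i => k i))).
  move=> z; rewrite big_bool /= fa mulr_sumr; congr (_ + _).
    by rewrite /monom big1 ?mulr1.
  by apply: eq_bigr => k _; rewrite mulrA.
apply: poly_le_sum => -[] _; first by apply: poly_le_monom; rewrite big1.
by apply: poly_le_sum => k; rewrite inE; exact: poly_le_monom.
Qed.

Lemma poly_le_prod E (J : finType) (f : J -> 'rV[R]_n -> R) :
  (forall j, poly_le E (f j)) -> poly_le (#|J| * E) (fun z => \prod_j f j z).
Proof.
move=> fE; rewrite cardT.
apply: (@poly_le_eq _ (fun z => \prod_(j <- enum J) f j z)).
  by move=> z; rewrite big_enum.
elim: (enum J) => [|j r IH].
  apply: (@poly_le_eq _ (fun z => 1 * monom z (fun=> 0%N))).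
    by move=> z; rewrite big_nil /monom big1 ?mulr1.
  by apply: poly_le_monom; rewrite big1.
rewrite /= mulSn; apply: poly_le_eq (poly_le_mul (fE j) IH).
by move=> z; rewrite big_cons.
Qed.

(** Weigh the multi-index [k] by [x ^+ (\sum_i k i - E)], which is at least 1,
    with the optimal [x = E / (E + n)]; the sum over all [k] is then a product of
    geometric series. *)
Lemma card_multi_indices E : (0 < n)%N -> (0 < E)%N ->
  #|multi_indices E|%:R <= (expR 1 * (1 + E%:R / n%:R)) ^+ n :> R.
Proof.
move=> n0 E0; pose u : R := n%:R / E%:R; pose x : R := (1 + u)^-1.
have u0 : 0 < u by rewrite divr_gt0 ?ltr0n.
have x0 : 0 < x by rewrite invr_gt0 addr_gt0.
have x1 : x <= 1 by rewrite invf_le1 ?addr_gt0 // lerDl ltW.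
have -> : 1 + E%:R / n%:R = (1 - x)^-1 :> R.
  have -> : 1 - x = u / (1 + u) by rewrite /x; field; rewrite gt_eqF ?addr_gt0.
  by rewrite invf_div mulrDl mul1r divff ?gt_eqF // addrC /u invf_div.
have xE0 : 0 < x ^+ E by rewrite exprn_gt0.
have cardx : #|multi_indices E|%:R * x ^+ E <= (1 - x)^-1 ^+ n.
  rewrite -sumr_const mulr_suml.
  have x10 : 0 < 1 - x.
    by rewrite subr_gt0 invf_lt1 ?addr_gt0 // ltrDl.
  apply: (@le_trans _ _ (\sum_(k : {ffun 'I_n -> 'I_E.+1}) \prod_i x ^+ k i)).
    rewrite big_mkcond; apply: ler_sum => k _; case: ifP; rewrite inE.
      move=> kE; rewrite mul1r prodrXr; exact: ler_wiXn2l (ltW x0) x1 _ _ kE.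
    by move=> _; apply: prodr_ge0 => i _; rewrite exprn_ge0 // ltW.
  rewrite -(bigA_distr_bigA (fun (i : 'I_n) (j : 'I_E.+1) => x ^+ j)) prodr_const card_ord.
  rewrite lerXn2r ?nnegrE ?invr_ge0 ?(ltW x10) ?sumr_ge0 // => [j _|].
    by rewrite exprn_ge0 // ltW.
  rewrite -[leRHS]mul1r ler_pdivlMr // mulrC -opprB mulNr -subrX1 opprB.
  by rewrite gerBl exprn_ge0 // ltW.
rewrite exprMn; apply: (@le_trans _ _ ((1 - x)^-1 ^+ n * (x ^+ E)^-1)).
  by rewrite ler_pdivlMr.
rewrite mulrC ler_wpM2r // ?exprn_ge0 ?invr_ge0 ?subr_ge0 //.
rewrite -exprVn /x invrK -expRM_natl mulr1.
have -> : n%:R = E%:R * u.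
  by rewrite mulrC /u divfK // pnatr_eq0 -lt0n.
rewrite expRM_natl lerXn2r ?nnegrE ?expR_ge0 ?expR_ge1Dx //.
by rewrite addr_ge0 // ltW.
Qed.

End polynomial_maps.
Arguments multi_indices : clear implicits.

(** * Sign vectors near the values of polynomials *)

(** Up to the factor 2, the mean, when a sign is flipped with probability 1/4,
    of the squared cosine of the angle between a coordinate vector and the vector
    with coordinates [1 + v] and [1 - v]. *)
Definition agreement (R : realType) (v : R) : R := (1 + v + v ^+ 2) / (1 + v ^+ 2).

Section sign_capacity.
Context {R : realType} {n d : nat} {J : finType}.
Variable (F : J -> 'rV[R]_n -> R).

(** The weight [W sg t] is the probability that independent flips with
    probability 1/4 lead from [sg] to [t]. The mean of the leverage scores with
    these weights is [2 ^- #|J|] times the product of the agreements or more, and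
    the sum of the means over [sg] is the sum of the scores. *)
Lemma sign_capacity (zeta : {ffun J -> bool} -> 'rV[R]_n) (b : R) :
  0 < b -> (forall j, poly_le d (F j)) ->
  (forall sg : {ffun J -> bool},
     b ^+ #|J| <= \prod_j agreement ((-1) ^+ sg j * F j (zeta sg))) ->
  b ^+ #|J| <= #|multi_indices n (#|J| * d)|%:R.
Proof.
move=> b0 Fd bF.
pose sgn (t : bool) : R := (-1) ^+ t.
pose g (t : {ffun J -> bool}) z := \prod_j (1 + sgn (t j) * F j z).
have gP t : poly_le (#|J| * d) (g t).
  by apply: poly_le_prod => j; exact: poly_le_affine.
pose a t := projT1 (cid (gP t)).
have ga t z : g t z = \sum_(k in multi_indices n (#|J| * d)) a t k * monom z (fun i => k i).
  by rewrite /a; case: cid.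
have [lev [levD levP]] := leverage_scores_fin (multi_indices n (#|J| * d)) a.
pose S z := \sum_(t : {ffun J -> bool}) g t z ^+ 2.
have levg t z : g t z ^+ 2 <= lev t * S z.
  rewrite ga; apply: le_trans (levP _ _) _; rewrite /S.
  by under [in leRHS]eq_bigr do rewrite ga.
have SE z : S z = \prod_j (2 * (1 + F j z ^+ 2)).
  transitivity (\sum_(t : {ffun J -> bool}) \prod_j (1 + sgn (t j) * F j z) ^+ 2).
    by apply: eq_bigr => t _; rewrite prodrXl.
  rewrite -(bigA_distr_bigA (fun j t => (1 + sgn t * F j z) ^+ 2)).
  by apply: eq_bigr => j _; rewrite big_bool /sgn /=; ring.
have S0 z : 0 < S z.
  by rewrite SE; apply: prodr_gt0 => j _; rewrite mulr_gt0 // ltr_pwDl ?sqr_ge0.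
pose w (s t : bool) : R := if s == t then 3 / 4 else 1 / 4.
pose W (s t : {ffun J -> bool}) := \prod_j w (s j) (t j).
have W0 s t : 0 <= W s t.
  by apply: prodr_ge0 => j _; rewrite /w; case: eqP => _; lra.
have W1 t : \sum_s W s t = 1.
  rewrite -(bigA_distr_bigA (fun j s => w s (t j))) big1 // => j _.
  by rewrite big_bool /w; case: (t j) => /=; field.
have WS s z : \sum_t W s t * g t z ^+ 2 / S z =
    2^-1 ^+ #|J| * \prod_j agreement (sgn (s j) * F j z).
  rewrite -mulr_suml SE -prodr_const -big_split -prodfV /=.
  transitivity ((\sum_(t : {ffun J -> bool})
      \prod_j (w (s j) (t j) * (1 + sgn (t j) * F j z) ^+ 2)) *
      \prod_j (2 * (1 + F j z ^+ 2))^-1).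
    by congr (_ * _); apply: eq_bigr => t _; rewrite big_split prodrXl.
  rewrite -(bigA_distr_bigA (fun j t => w (s j) t * (1 + sgn t * F j z) ^+ 2)).
  rewrite -big_split; apply: eq_bigr => j _; rewrite /= big_bool /agreement.
  have F0 : 1 + F j z ^+ 2 != 0 by rewrite gt_eqF // ltr_pwDl ?sqr_ge0.
  rewrite /w /sgn; case: (s j) => /=; field; rewrite ?mulN1r ?sqrrN ?mul1r F0 //.
(* Summing over [t] first brings back the leverage scores, as the weights of
   each [t] sum to 1; there are [2 ^ #|J|] sign vectors to sum over. *)
apply: le_trans levD.
have -> : \sum_t lev t = \sum_(s : {ffun J -> bool}) \sum_t W s t * lev t.
  by rewrite exchange_big; apply: eq_bigr => t _; rewrite -mulr_suml W1 mul1r.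
apply: (@le_trans _ _ (\sum_(s : {ffun J -> bool}) 2^-1 ^+ #|J| * b ^+ #|J|)).
  rewrite sumr_const card_ffun card_bool -[leRHS]mulr_natl natrX mulrA -exprMn.
  by rewrite divff // expr1n mul1r.
apply: ler_sum => s _.
apply: (@le_trans _ _ (\sum_t W s t * g t (zeta s) ^+ 2 / S (zeta s))).
  by rewrite WS ler_wpM2l ?exprn_ge0 //; exact: bF.
apply: ler_sum => t _; rewrite -mulrA ler_wpM2l // ler_pdivrMr //.
Qed.

End sign_capacity.

Lemma agreement_near1 (R : realType) (v : R) : `|v - 1| <= 1 / 3 ->
  10 / 7 <= agreement v.
Proof.
rewrite ler_norml => /andP[v1 v2]; rewrite /agreement ler_pdivlMr ?ltr_pwDl ?sqr_ge0 //.
rewrite expr2; nra.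
Qed.

(** As [1 + x <= expR x], it is enough to bound the agreement from below by
    [3 / 2 / (1 + 5 / 4 * `|v - 1|)]; with the rate 1 instead of 5/4 this bound
    would fail for [v] between -1 and -1/2. *)
Lemma agreement_ge (R : realType) (v : R) :
  3 / 2 * expR (- (5 / 4) * `|v - 1|) <= agreement v.
Proof.
have D0 : 0 < 1 + v ^+ 2 by rewrite ltr_pwDl ?sqr_ge0.
set e := `|v - 1|; have e0 : 0 <= e by exact: normr_ge0.
have c0 : 0 < 1 + 5 / 4 * e by lra.
apply: (@le_trans _ _ (3 / 2 * (1 + 5 / 4 * e)^-1)).
  rewrite mulNr expRN ler_pM2l ?lef_pV2 ?posrE ?expR_gt0 ?expR_ge1Dx //; lra.
rewrite ler_pdivrMr // /agreement mulrAC ler_pdivlMr //.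
rewrite /e; case: (lerP 0 (v - 1)) => v1.
  rewrite ger0_norm //; move: v1; set t := v - 1 => t0.
  have -> : v = 1 + t by rewrite /t; ring.
  by rewrite expr2; nra.
rewrite ltr0_norm //; move: v1; rewrite -oppr_gt0; set t := - (v - 1) => t0.
have -> : v = 1 - t by rewrite /t; ring.
rewrite -subr_ge0.
have -> : (1 + (1 - t) + (1 - t) ^+ 2) * (1 + 5 / 4 * t) - 3 / 2 * (1 + (1 - t) ^+ 2)
    = t * (5 / 4 * (t - 17 / 10) ^+ 2 + 11 / 80) by field.
apply: mulr_ge0; first exact: ltW.
have := sqr_ge0 (t - 17 / 10); lra.
Qed.

Section counting.
Context {R : realType}.

Lemma expR1_le4 : expR 1 <= 4 :> R.
Proof.
have -> : 1 = 1 / 2 + 1 / 2 :> R by field.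
rewrite expRD; have h : expR (1 / 2) <= 2 :> R.
  have := expR_ge1Dx (- (1 / 2) : R); rewrite expRN.
  rewrite -[leRHS]mul1r ler_pdivlMr ?expR_gt0 //; lra.
have h0 := expR_gt0 (1 / 2 : R); nra.
Qed.

Lemma ln2_ge : 1 / 2 <= ln 2 :> R.
Proof.
rewrite -ler_expR lnK ?posrE // -[leRHS]invrK -[leLHS]invrK -expRN.
rewrite lef_pV2 ?posrE ?expR_gt0 ?invr_gt0 //.
have := expR_ge1Dx (- (1 / 2) : R); lra.
Qed.

(** With [t = N / (16 * n)] the base of the bound [card_multi_indices] is below
    [2 ^ (8 * t)], because [16 * t * d <= 16 * t * 2 ^ t] and
    [t <= 2 ^ (7 * (t - 1))]; and [2 ^ (8 * t * n)] is the square root of [2 ^ N]. *)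
Lemma few_multi_indices (n d N : nat) : (1 <= n)%N -> (2 <= d)%N ->
  16 * (n%:R * log2 d%:R) <= N%:R :> R ->
  #|multi_indices n (N * d)|%:R < (10 / 7) ^+ N :> R.
Proof.
move=> n1 d2 hN.
have n0 : 0 < n%:R :> R by rewrite ltr0n.
have ln20 : 0 < ln 2 :> R by apply: lt_le_trans ln2_ge; lra.
have L1 : 1 <= log2 d%:R :> R.
  by rewrite /log2 ler_pdivlMr // mul1r ler_ln ?posrE ?ltr0n ?ler_nat // ltnW.
pose t : R := N%:R / (16 * n%:R).
have tL : log2 d%:R <= t.
  by rewrite /t ler_pdivlMr ?mulr_gt0 // mulrCA (mulrC (log2 _)).
have t1 : 1 <= t by exact: le_trans tL.
have NE : N%:R = 16 * n%:R * t by rewrite /t mulrC divfK // gt_eqF ?mulr_gt0.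
have dt : d%:R <= expR (t * ln 2) :> R.
  have d0 : 0 < d%:R :> R by rewrite ltr0n ltnW.
  rewrite -[leLHS]lnK ?posrE // ler_expR -ler_pdivrMr //.
have N0 : (0 < N)%N.
  by rewrite -(ltr0n R) NE; apply: mulr_gt0; [exact: mulr_gt0|lra].
apply: le_lt_trans (card_multi_indices n1 _) _; first by rewrite muln_gt0 N0 ltnW.
have base : expR 1 * (1 + (N * d)%:R / n%:R) < expR (8 * t * ln 2).
  have -> : (N * d)%:R / n%:R = 16 * t * d%:R :> R.
    by rewrite natrM NE; field; rewrite gt_eqF.
  have h7 : 128 * t <= expR (7 * t * ln 2).
    have -> : 7 * t * ln 2 = 7%:R * ln 2 + 7 * (t - 1) * ln 2 :> R by ring.
    rewrite expRD expRM_natl lnK ?posrE //.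
    have -> : 2 ^+ 7 = 128 :> R by rewrite -natrX.
    rewrite ler_pM2l //; apply: le_trans (expR_ge1Dx _).
    have := ln2_ge; nra.
  have -> : 8 * t * ln 2 = t * ln 2 + 7 * t * ln 2 :> R by ring.
  rewrite expRD; set x := expR (t * ln 2) in dt *.
  have x1 : 1 <= x by rewrite -expR0 ler_expR mulr_ge0 ?(ltW ln20) //; lra.
  apply: (@le_lt_trans _ _ (4 * (1 + 16 * t * x))).
    have d0 : 0 <= d%:R :> R by [].
    apply: ler_pM; [exact: expR_ge0|by nra|exact: expR1_le4|nra].
  apply: (@lt_le_trans _ _ (x * (128 * t))); first nra.
  by rewrite ler_pM2l //; lra.
apply: (@lt_le_trans _ _ (expR (8 * t * ln 2) ^+ n)).
  by rewrite ltr_pXn2r ?nnegrE ?expR_ge0 ?mulr_ge0 ?expR_ge0 ?addr_ge0 ?divr_ge0.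
rewrite -expRM_natl -[leRHS](@lnK _ _) ?posrE ?exprn_gt0 // ler_expR.
rewrite [leRHS]lnXn // -[leRHS]mulr_natl NE.
have -> : n%:R * (8 * t * ln 2) = 16 * n%:R * t * (ln 2 / 2) :> R by field.
rewrite ler_wpM2l //; first by rewrite !mulr_ge0 //; lra.
rewrite ler_pdivrMr // mulr_natr -lnXn // ler_ln ?posrE ?exprn_gt0 //.
rewrite expr2; lra.
Qed.

End counting.

(** The base 10/7 exceeds the square root of 2, so that [few_multi_indices]
    applies; it is below the agreements at distance 1/3 from 1 ([agreement_near1])
    and below [3 / 2 * expR (- (5 / 4) / 30)], which by [agreement_ge] bounds from
    below the geometric mean of agreements at mean distance 1/30 from 1. *)
Lemma unreachable_signs (R : realType) (n d : nat) (J : finType)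
    (F : J -> 'rV[R]_n -> R) :
  (1 <= n)%N -> (2 <= d)%N -> (forall j, poly_le d (F j)) ->
  16 * (n%:R * log2 d%:R) <= #|J|%:R :> R ->
  exists sg : {ffun J -> bool}, forall z,
    (exists j, 1 / 3 < `|(-1) ^+ sg j - F j z|) /\
    #|J|%:R / 30 < \sum_j `|(-1) ^+ sg j - F j z|.
Proof.
move=> n1 d2 Fd JN.
have sgE (b : bool) (y : R) : `|(-1) ^+ b - y| = `|(-1) ^+ b * y - 1|.
  by case: b; [rewrite expr1 mulN1r addrC|rewrite expr0 mul1r distrC].
have [sg sgP] : exists sg : {ffun J -> bool}, forall z,
    \prod_j agreement ((-1) ^+ sg j * F j z) < (10 / 7) ^+ #|J|.
  apply: contrapT => /forallNP H.
  have {}H (sg : {ffun J -> bool}) : exists z,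
      (10 / 7) ^+ #|J| <= \prod_j agreement ((-1) ^+ sg j * F j z).
    by have /existsNP[z /negP zP] := H sg; exists z; rewrite leNgt.
  have := @sign_capacity R n d J F (fun sg => projT1 (cid (H sg))) (10 / 7).
  move=> /(_ _ Fd); apply/not_implyP; split=> //; apply/not_implyP; split.
    by move=> sg; case: cid.
  by apply/negP; rewrite -ltNge few_multi_indices.
exists sg => z; have {}sgP := sgP z; split.
  apply: contrapT => /forallNP H; move: sgP; apply/negP; rewrite -leNgt.
  rewrite -prodr_const; apply: ler_prod => j _; rewrite divr_ge0 //=.
  by apply: agreement_near1; rewrite -sgE leNgt; apply/negP.
rewrite ltNge; apply/negP => H; move: sgP; apply/negP; rewrite -leNgt.
apply: (@le_trans _ _ (\prod_(j : J)
    (3 / 2 * expR (- (5 / 4) * `|(-1) ^+ sg j - F j z|)))); last first.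
  apply: ler_prod => j _; rewrite mulr_ge0 ?expR_ge0 ?divr_ge0 //=.
  by rewrite sgE agreement_ge.
rewrite big_split /= prodr_const -expR_sum -mulr_sumr.
apply: (@le_trans _ _ ((3 / 2) ^+ #|J| * expR (- (1 / 24)) ^+ #|J|)).
  rewrite -exprMn lerXn2r ?nnegrE ?mulr_ge0 ?expR_ge0 ?divr_ge0 //.
  have := expR_ge1Dx (- (1 / 24) : R); lra.
rewrite ler_wpM2l ?exprn_ge0 ?divr_ge0 // -expRM_natl ler_expR.
lra.
Qed.

(** * The one-dimensional bump *)

Section bump.
Context {R : realType}.
Implicit Types (x y t : R) (p k : nat).

(** A Bernstein polynomial of degree [a + b], without its binomial coefficient. *)
Definition bern (a b : nat) : {poly R} := 'X^a * (1 - 'X) ^+ b.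

Lemma hornerBern a b x : (bern a b).[x] = x ^+ a * (1 - x) ^+ b.
Proof. by rewrite /bern !hornerE. Qed.

Lemma deriv_bern a b : (bern a.+1 b.+1)^`() =
  a.+1%:R *: bern a b.+1 - b.+1%:R *: bern a.+1 b.
Proof.
rewrite /bern derivM derivXn deriv_exp derivB derivX -polyC1 derivC sub0r /=.
by rewrite !mulN1r polyC1 mulNrn mulrN !scaler_nat mulrnAl mulrnAr.
Qed.

(** Each differentiation of [x ^ a (1 - x) ^ b] gives two terms with factors at
    most [p], which after division by the common lower power are weighted by
    [1 - x] and [x], so that the bound gains a factor [p] only. *)
Lemma derivn_bern_le p a b k x : (a <= p)%N -> (b <= p)%N -> (k <= a)%N ->
  (k <= b)%N -> 0 <= x <= 1 ->
  `|(bern a b)^`(k).[x]| <= p%:R ^+ k * (x ^+ (a - k) * (1 - x) ^+ (b - k)).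
Proof.
move=> ap bp ka kb /andP[x0 x1]; have x1' : 0 <= 1 - x by lra.
elim: k a b ap bp ka kb => [|k IH] a b ap bp ka kb.
  by rewrite derivn0 hornerBern expr0 mul1r !subn0 ger0_norm // mulr_ge0 ?exprn_ge0.
case: a b ap bp ka kb => [//|a] [//|b] ap bp ka kb.
rewrite derivSn deriv_bern derivnB !derivnZ !hornerE.
set u := x ^+ (a.+1 - k.+1) * (1 - x) ^+ (b.+1 - k.+1).
have u0 : 0 <= u by rewrite mulr_ge0 ?exprn_ge0.
have pk0 : 0 <= p%:R ^+ k * u by rewrite mulr_ge0 ?exprn_ge0.
have h1 : `|(bern a b.+1)^`(k).[x]| <= p%:R ^+ k * u * (1 - x).
  apply: (le_trans (IH a b.+1 (ltnW ap) bp ka (leqW kb))).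
  by rewrite /u !subSS subSn // exprSr !mulrA.
have h2 : `|(bern a.+1 b)^`(k).[x]| <= p%:R ^+ k * u * x.
  apply: (le_trans (IH a.+1 b ap (ltnW bp) (leqW ka) kb)).
  by rewrite /u !subSS subSn // exprS; rewrite le_eqVlt; apply/orP; left; apply/eqP; ring.
apply: (le_trans (ler_normB _ _)); rewrite !normrM !normr_nat.
have ha : a.+1%:R <= p%:R :> R by rewrite ler_nat.
have hb : b.+1%:R <= p%:R :> R by rewrite ler_nat.
apply: (@le_trans _ _ (p%:R * (p%:R ^+ k * u * (1 - x)) + p%:R * (p%:R ^+ k * u * x))).
  by apply: lerD; apply: ler_pM.
have -> : p%:R * (p%:R ^+ k * u * (1 - x)) + p%:R * (p%:R ^+ k * u * x) = p%:R ^+ k.+1 * u.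
  by rewrite exprS; ring.
by rewrite /u mulrA.
Qed.

Lemma horner_mvt (P : {poly R}) x y : 0 <= x <= 1 -> 0 <= y <= 1 ->
  exists c, [/\ 0 <= c <= 1, `|c - x| <= `|y - x| &
    P.[y] - P.[x] = P^`().[c] * (y - x)].
Proof.
have mvt (u v : R) : u <= v -> exists2 c, u <= c <= v &
    P.[v] - P.[u] = P^`().[c] * (v - u).
  move=> uv; have [|c cuv ->] := @MVT_segment R (horner P) (horner P^`()) u v uv
    (fun z _ => is_derive_poly P z).
    by apply: continuous_subspaceT; exact: continuous_horner.
  by exists c; move: cuv; rewrite // in_itv.
move=> /andP[x0 x1] /andP[y0 y1]; case: (leP x y) => [xy|/ltW yx].
  have [c /andP[xc cy] E] := mvt _ _ xy; exists c; split=> //; first by apply/andP; split; lra.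
  by rewrite !ger0_norm; lra.
have [c /andP[xc cy] E] := mvt _ _ yx; exists c; split; first by apply/andP; split; lra.
  by rewrite !ler0_norm; lra.
by rewrite -opprB E; ring.
Qed.

Lemma horner_lip (P : {poly R}) C x y : 0 <= x <= 1 -> 0 <= y <= 1 ->
  (forall z, 0 <= z <= 1 -> `|P^`().[z]| <= C) ->
  `|P.[x] - P.[y]| <= C * `|x - y|.
Proof.
move=> x01 y01 PC; have [c [c01 _ ->]] := horner_mvt P y01 x01.
by rewrite normrM ler_wpM2r // PC.
Qed.

Lemma horner_taylor1 (P : {poly R}) C x y : 0 <= x <= 1 -> 0 <= y <= 1 ->
  (forall z, 0 <= z <= 1 -> `|P^`(2).[z]| <= C) ->
  `|P.[y] - P.[x] - (y - x) * P^`().[x]| <= C * (y - x) ^+ 2.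
Proof.
move=> x01 y01 PC; have [c [c01 cx ->]] := horner_mvt P x01 y01.
rewrite mulrC -mulrBr normrM -[(y - x) ^+ 2]real_normK ?num_real // expr2 mulrCA.
rewrite ler_wpM2l //; apply: (le_trans (horner_lip c01 x01 PC)).
by rewrite ler_wpM2l //; apply: le_trans (PC x x01).
Qed.

Definition clamp x : R := Num.max 0 (Num.min 1 x).

Lemma clamp_ge0 x : 0 <= clamp x.
Proof. by rewrite /clamp le_max lexx. Qed.

Lemma clamp_le1 x : clamp x <= 1.
Proof. by rewrite /clamp ge_max ler01 ge_min lexx. Qed.

Lemma clamp_id x : 0 <= x <= 1 -> clamp x = x.
Proof. by case/andP=> x0 x1; rewrite /clamp (min_idPr x1) (max_idPr x0). Qed.

Lemma clamp_le0E x : x <= 0 -> clamp x = 0.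
Proof. by move=> x0; apply/max_idPl; rewrite ge_min x0 orbT. Qed.

Lemma clamp_ge1E x : 1 <= x -> clamp x = 1.
Proof. by move=> x1; rewrite /clamp (min_idPl x1); apply/max_idPr. Qed.

Variant clamp_spec x : R -> Type :=
| ClampLow of x <= 0 : clamp_spec x 0
| ClampIn of 0 < x < 1 : clamp_spec x x
| ClampHigh of 1 <= x : clamp_spec x 1.

Lemma clampP x : clamp_spec x (clamp x).
Proof.
case: (lerP x 0) => x0; first by rewrite clamp_le0E //; exact: ClampLow.
case: (lerP 1 x) => x1; first by rewrite clamp_ge1E //; exact: ClampHigh.
by rewrite clamp_id ?(ltW x0) ?(ltW x1) //; apply: ClampIn; rewrite x0.
Qed.

Lemma clamp_nondecreasing x y : x <= y -> clamp x <= clamp y.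
Proof.
move=> xy; case: (clampP x) => [x0|/andP[x0 x1]|x1]; first exact: clamp_ge0.
  case: (clampP y) => [y0|//|y1]; lra.
by rewrite clamp_ge1E //; lra.
Qed.

Lemma clamp_lip x y : `|clamp x - clamp y| <= `|x - y|.
Proof.
wlog xy : x y / y <= x.
  by move=> H; case: (leP y x) => [|/ltW] /H //; rewrite distrC (distrC y).
rewrite !ger0_norm ?subr_ge0 ?clamp_nondecreasing //.
by case: (clampP x) => [x0|/andP[x0 x1]|x1]; case: (clampP y) => [y0|/andP[y0 y1]|y1]; lra.
Qed.

Lemma sum_clamp q x : \sum_(j < q) clamp (x - j%:R) = Num.max 0 (Num.min q%:R x).
Proof.
elim: q => [|q IH].
  by rewrite big_ord0; apply/esym/max_idPl; rewrite ge_min lexx.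
rewrite big_ord_recr /= IH -natr1.
have q0 : 0 <= q%:R :> R by [].
case: (clampP (x - q%:R)) => [h|/andP[h1 h2]|h].
- by rewrite addr0 !(min_idPr _) //; lra.
- by rewrite (min_idPl _) 1?(max_idPr _) 1?(min_idPr _) 1?(max_idPr _) //; lra.
- by rewrite !(min_idPl _) 1?(max_idPr _) 1?(max_idPr _) //; lra.
Qed.

(** The translates of [clamp] add up to a truncation of the identity, so their
    increments, which have the same sign, cannot exceed [`|x - y|] together. *)
Lemma sum_clamp_lip q x y :
  \sum_(j < q) `|clamp (x - j%:R) - clamp (y - j%:R)| <= `|x - y|.
Proof.
wlog xy : x y / y <= x.
  move=> H; case: (leP y x) => [|/ltW] /H //; rewrite (distrC y) => le.
  by under eq_bigr do rewrite distrC.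
under eq_bigr do rewrite ger0_norm ?subr_ge0 ?clamp_nondecreasing ?lerD2r //.
rewrite sumrB !sum_clamp ger0_norm ?subr_ge0 //.
rewrite /Num.max /Num.min; do ! case: ifP; lra.
Qed.

(** At most one translate by an integer is nonzero at a given point. *)
Lemma sum_localized q (f : R -> R) M x :
  0 <= M -> (forall y, y <= 0 \/ 1 <= y -> f y = 0) -> (forall y, `|f y| <= M) ->
  \sum_(j < q) `|f (x - j%:R)| <= M.
Proof.
move=> M0 f0 fM; elim: q => [|q IH]; first by rewrite big_ord0.
rewrite big_ord_recr /=; case: (lerP x q%:R) => xq.
  by rewrite (f0 (x - q%:R)) ?normr0 ?addr0 //; left; lra.
rewrite big1 ?add0r // => j _; rewrite f0 ?normr0 //; right.
have : j.+1%:R <= q%:R :> R by rewrite ler_nat.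
by rewrite -natr1; lra.
Qed.


Variable p : nat.

(** The [k]-th derivative of the function equal to [(x (1 - x)) ^ p] on the unit
    interval and to 0 elsewhere: for [k < p] the derivative of the polynomial
    vanishes at both ends, so that precomposing with [clamp] extends it by 0. *)
Definition bump_deriv k x := (bern p p)^`(k).[clamp x].

Lemma bump0E x : bump_deriv 0 x = (clamp x * (1 - clamp x)) ^+ p.
Proof. by rewrite /bump_deriv derivn0 hornerBern exprMn. Qed.

Lemma derivn_bern_le1 k x : (k <= p)%N -> 0 <= x <= 1 ->
  `|(bern p p)^`(k).[x]| <= p%:R ^+ k.
Proof.
move=> kp x01; apply: (le_trans (derivn_bern_le (leqnn p) (leqnn p) kp kp x01)).
case/andP: x01 => x0 x1.
rewrite -[leRHS]mulr1 ler_wpM2l ?exprn_ge0 // mulr_ile1 ?exprn_ge0 ?exprn_ile1 //; lra.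
Qed.

Lemma bump_le k x : (k < p)%N -> `|bump_deriv k x| <= p%:R ^+ k / 4.
Proof.
move=> kp; have x01 : 0 <= clamp x <= 1 by rewrite clamp_ge0 clamp_le1.
apply: (le_trans (derivn_bern_le (leqnn p) (leqnn p) (ltnW kp) (ltnW kp) x01)).
rewrite ler_wpM2l ?exprn_ge0 // -exprMn; case/andP: x01.
set y := clamp x => y0 y1; have -> : (p - k)%N = (p - k.+1).+1 by lia.
have yy : 0 <= y * (1 - y) by rewrite mulr_ge0 //; lra.
have y4 : y * (1 - y) <= 4^-1 by have := sqr_ge0 (y - 1 / 2); rewrite expr2; lra.
rewrite exprS -[leRHS]mulr1 ler_pM ?exprn_ge0 // exprn_ile1 //.
by apply: le_trans y4 _; lra.
Qed.

Lemma bump_lip k x y : (k < p)%N ->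
  `|bump_deriv k x - bump_deriv k y| <= p%:R ^+ k.+1 * `|clamp x - clamp y|.
Proof.
move=> kp; apply: horner_lip; rewrite ?clamp_ge0 ?clamp_le1 // => z z01.
by rewrite -derivnS derivn_bern_le1.
Qed.

Lemma bump_out k y : (k < p)%N -> y <= 0 \/ 1 <= y -> bump_deriv k y = 0.
Proof.
move=> kp yout; apply/eqP; rewrite -normr_le0.
have x01 : 0 <= clamp y <= 1 by rewrite clamp_ge0 clamp_le1.
apply: (le_trans (derivn_bern_le (leqnn p) (leqnn p) (ltnW kp) (ltnW kp) x01)).
rewrite -exprMn; case: yout => h.
  by rewrite clamp_le0E // mul0r expr0n subn_eq0 leqNgt kp mulr0.
by rewrite clamp_ge1E // subrr mulr0 expr0n subn_eq0 leqNgt kp mulr0.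
Qed.

(** Where [bump_deriv k.+1 x] is nonzero, [x] is in the open interval and [clamp]
    moves [x + t] only if [x] is within [`|t|] of an end point, at which
    [bump_deriv k.+1] vanishes. *)
Lemma bump_taylor k x t : (k.+1 < p)%N ->
  `|bump_deriv k (x + t) - bump_deriv k x - t * bump_deriv k.+1 x| <= 2 * p%:R ^+ k.+2 * t ^+ 2.
Proof.
move=> kp; set C := p%:R ^+ k.+2.
have C0 : 0 <= C by rewrite exprn_ge0.
set c := clamp x; set c' := clamp (x + t).
have cc : `|c' - c| <= `|t|.
  by apply: le_trans (clamp_lip _ _) _; rewrite addrAC subrr add0r.
have h1 : `|bump_deriv k (x + t) - bump_deriv k x - (c' - c) * bump_deriv k.+1 x| <= C * t ^+ 2.
  apply: (@le_trans _ _ (C * (c' - c) ^+ 2)).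
    rewrite /bump_deriv derivnS; apply: horner_taylor1; rewrite ?clamp_ge0 ?clamp_le1 // => z z01.
    exact: (@derivn_bern_le1 k.+2 z kp z01).
  rewrite ler_wpM2l // -[leLHS]real_normK ?num_real //.
  by rewrite -[leRHS]real_normK ?num_real // lerXn2r ?nnegrE.
have h2 : `|((c' - c) - t) * bump_deriv k.+1 x| <= C * t ^+ 2.
  have t20 : 0 <= C * t ^+ 2 by rewrite mulr_ge0 // sqr_ge0.
  case: (clampP x) @c cc h1 => [x0|/andP[x0 x1]|x1] c cc h1.
  - by rewrite bump_out ?mulr0 ?normr0 //; left.
  - rewrite normrM -[t ^+ 2]real_normK ?num_real // expr2 mulrA mulrC.
    rewrite /c' /c; case: (clampP (x + t)) => [xt|xt|xt].
    + apply: ler_pM => //.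
        have := bump_lip x 0 kp; rewrite (@bump_out _ 0) //; last by left.
        rewrite subr0 clamp_id ?(ltW x0) ?(ltW x1) // clamp_le0E // subr0.
        move=> /le_trans; apply; rewrite ler_wpM2l // (ger0_norm (ltW x0)).
        by have := ler_norm (- t); rewrite normrN; lra.
      have tn := ler_norm (- t); rewrite normrN in tn.
      by rewrite ger0_norm; lra.
    + have -> : x + t - x - t = 0 by ring.
      by rewrite normr0 mulr0 mulr_ge0 // mulr_ge0.
    + apply: ler_pM => //.
        have := bump_lip x 1 kp; rewrite (@bump_out _ 1) //; last by right.
        rewrite subr0 clamp_id ?(ltW x0) ?(ltW x1) // clamp_ge1E //.
        move=> /le_trans; apply; rewrite ler_wpM2l // distrC (@ger0_norm _ (1 - x)); last lra.
        by have := ler_norm t; lra.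
      have tn := ler_norm t.
      by rewrite ler0_norm; lra.
  - by rewrite bump_out ?mulr0 ?normr0 //; right.
have -> : bump_deriv k (x + t) - bump_deriv k x - t * bump_deriv k.+1 x =
    (bump_deriv k (x + t) - bump_deriv k x - (c' - c) * bump_deriv k.+1 x) +
    ((c' - c) - t) * bump_deriv k.+1 x.
  by ring.
by apply: (le_trans (ler_normD _ _)); lra.
Qed.

End bump.

(** * Signed sums of bumps *)

Section tensor_sum.
Context {R : realType} {s q : nat}.
Variable sg : {ffun {ffun 'I_s -> 'I_q} -> bool}.
Implicit Types f g : 'I_s -> 'I_q -> R.

(** The sum over the cells [j] of the signed products; it is linear in each [f i]
    separately, which [tensor_sum_sub] uses to compare two sums that differ along
    one axis. *)
Definition tensor_sum f : R :=
  \sum_(j : {ffun 'I_s -> 'I_q}) (-1) ^+ sg j * \prod_i f i (j i).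

Lemma tensor_sum_le f (M : 'I_s -> R) :
  (forall i, \sum_j `|f i j| <= M i) -> `|tensor_sum f| <= \prod_i M i.
Proof.
move=> fM; apply: (le_trans (ler_norm_sum _ _ _)).
apply: (@le_trans _ _ (\prod_i \sum_j `|f i j|)); last first.
  by apply: ler_prod => i _; rewrite fM sumr_ge0.
rewrite (bigA_distr_bigA (fun i j => `|f i j|)); apply: ler_sum => j _.
by rewrite normrMsign normr_prod.
Qed.

Lemma tensor_sum_sub f g i (c : R) :
  (forall i' j, i' != i -> f i' j = g i' j) ->
  tensor_sum f - c * tensor_sum g =
  tensor_sum (fun i' j => if i' == i then f i j - c * g i j else f i' j).
Proof.
move=> fg; rewrite /tensor_sum mulr_sumr -sumrB; apply: eq_bigr => j _.
rewrite (bigD1 i) // [X in _ - _ * (_ * X)](bigD1 i) // [in RHS](bigD1 i) //= eqxx.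
have -> : \prod_(i' | i' != i) g i' (j i') = \prod_(i' | i' != i) f i' (j i').
  by apply: eq_bigr => i' i'i; rewrite fg.
set h := (X in _ = _ * (_ * X)).
have -> : h = \prod_(i' | i' != i) f i' (j i').
  by apply: eq_bigr => i' /negbTE ->.
rewrite {h}; move: (\prod_(_ | _) _) (f i (j i)) (g i (j i)) ((-1) ^+ _) => ? ? ? ?.
by ring.
Qed.

End tensor_sum.

Section wave.
Context {R : realType} {s q : nat}.
Variable (p : nat) (sg : {ffun {ffun 'I_s -> 'I_q} -> bool}).
Hypothesis s0 : (0 < s)%N.
Implicit Types (k : 'I_s -> nat) (x y : 'rV[R]_s).

(** The partial derivative with [k i] differentiations along each axis [i], up to
    a power of [q], of the signed sum of the bumps. *)
Definition wave k x : R :=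
  tensor_sum sg (fun i (j : 'I_q) => bump_deriv p (k i) (q%:R * x 0 i - j%:R)).

Lemma wave_eq k k' x y : k =1 k' -> (forall i, x 0 i = y 0 i) -> wave k x = wave k' y.
Proof.
move=> kk xy; apply: eq_bigr => j _; congr (_ * _); apply: eq_bigr => i _.
by rewrite kk xy.
Qed.

Lemma sum_bump_le (k : nat) (y : R) : (k < p)%N ->
  \sum_(j < q) `|bump_deriv p k (y - j%:R)| <= p%:R ^+ k / 4.
Proof.
move=> kp; apply: sum_localized => [|z zout|z].
- by rewrite divr_ge0 ?exprn_ge0.
- exact: bump_out.
- exact: bump_le.
Qed.

Lemma sum_bump_le1 (k : nat) (y : R) : (k < p)%N ->
  \sum_(j < q) `|bump_deriv p k (y - j%:R)| <= p%:R ^+ k.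
Proof.
move=> kp; apply: le_trans (sum_bump_le y kp) _.
have : 0 <= p%:R ^+ k :> R by rewrite exprn_ge0.
by lra.
Qed.

Lemma prod_exp_sum k : \prod_i p%:R ^+ k i = p%:R ^+ (\sum_i k i) :> R.
Proof. by rewrite prodrXr. Qed.

(** One of the [s] factors 1/4 is kept: the Hölder condition needs it when
    [p = 1] and [s = 1]. *)
Lemma wave_le k x : (forall i, (k i < p)%N) ->
  `|wave k x| <= p%:R ^+ (\sum_i k i) / 4.
Proof.
move=> kp; pose i0 := Ordinal s0.
apply: (@le_trans _ _ (\prod_i (p%:R ^+ k i * (if i == i0 then 1 / 4 else 1)))).
  apply: tensor_sum_le => i; case: eqP => _; rewrite ?mulr1 ?sum_bump_le1 //.
  by rewrite mul1r sum_bump_le.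
by rewrite big_split /= prod_exp_sum -big_mkcond big_pred1_eq mul1r.
Qed.

Lemma prod_exp_sum1 k i (M : R) :
  \prod_i' (if i' == i then p%:R ^+ k i * M else p%:R ^+ k i') =
  p%:R ^+ (\sum_i k i) * M.
Proof.
rewrite -prod_exp_sum (bigD1 i) // [in RHS](bigD1 i) //= eqxx mulrAC.
by congr (_ * _ * _); apply: eq_bigr => i' /negbTE ->.
Qed.

Lemma wave_lip1 k x y i : (forall i, (k i < p)%N) ->
  (forall i', i' != i -> x 0 i' = y 0 i') ->
  `|wave k x - wave k y| <= p%:R ^+ (\sum_i k i).+1 * q%:R * `|x 0 i - y 0 i|.
Proof.
move=> kp xy; rewrite -[wave k y]mul1r /wave (@tensor_sum_sub _ _ _ _ _ _ i); last first.
  by move=> i' j i'i; rewrite xy.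
rewrite exprSr -!mulrA -(prod_exp_sum1 k i).
apply: tensor_sum_le => i'; case: eqP => [_|_]; last exact: sum_bump_le1.
under eq_bigr do rewrite mul1r.
apply: (@le_trans _ _ (p%:R ^+ (k i).+1 *
    \sum_(j < q) `|clamp (q%:R * x 0 i - j%:R) - clamp (q%:R * y 0 i - j%:R)|)).
  by rewrite mulr_sumr; apply: ler_sum => j _; exact: bump_lip.
rewrite exprSr -mulrA ler_wpM2l ?exprn_ge0 // ler_wpM2l //.
apply: (le_trans (sum_clamp_lip _ _ _)).
by rewrite -mulrBr normrM ger0_norm.
Qed.

(** Change the coordinates from those of [y] to those of [x] one at a time. *)
Lemma wave_lip k x y : (forall i, (k i < p)%N) ->
  `|wave k x - wave k y| <=
    p%:R ^+ (\sum_i k i).+1 * q%:R * \sum_i `|x 0 i - y 0 i|.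
Proof.
move=> kp; pose mix r : 'rV[R]_s := \row_(i < s) (if (i < r)%N then x 0 i else y 0 i).
have -> : wave k x - wave k y = \sum_(i < s) (wave k (mix i.+1) - wave k (mix i)).
  rewrite -(big_mkord xpredT (fun i => wave k (mix i.+1) - wave k (mix i))).
  rewrite (telescope_sumr (fun i => wave k (mix i))) //.
  by congr (_ - _); apply: wave_eq => // i; rewrite mxE ?ltn_ord.
apply: (le_trans (ler_norm_sum _ _ _)); rewrite mulr_sumr; apply: ler_sum => i _.
apply: le_trans (wave_lip1 (i := i) kp _) _.
  move=> i' i'i; rewrite !mxE ltnS leq_eqVlt.
  by have -> : (i' == i :> nat) = false by exact: negbTE.
by rewrite !mxE ltnSn ltnn.
Qed.

Definition incr_at i k : 'I_s -> nat := fun i' => (k i' + (i' == i))%N.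

Lemma wave_taylor k i : (forall i, (k i < p)%N) -> ((k i).+1 < p)%N ->
  exists2 C : R, 0 <= C & forall x t,
    `|wave k (x + t *: 'e_i) - wave k x - t * q%:R * wave (incr_at i k) x|
      <= C * t ^+ 2.
Proof.
move=> kp kip; pose B : R := q%:R * (2 * p%:R ^+ 2 * q%:R ^+ 2).
exists (p%:R ^+ (\sum_i k i) * B).
  by rewrite !mulr_ge0 ?exprn_ge0.
move=> x t; rewrite -[wave k x]mul1r /wave.
have offi i' : i' != i -> (x + t *: 'e_i) 0 i' = x 0 i'.
  by move=> i'i; rewrite !mxE (negbTE i'i) mulr0 addr0.
rewrite (@tensor_sum_sub _ _ _ _ _ _ i); last by move=> i' j i'i; rewrite offi.
rewrite (@tensor_sum_sub _ _ _ _ _ _ i); last first.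
  by move=> i' j i'i; rewrite (negbTE i'i) offi // /incr_at (negbTE i'i) addn0.
rewrite -mulrA -(prod_exp_sum1 k i); apply: tensor_sum_le => i'.
case: eqP => [_|_]; last by rewrite sum_bump_le1.
rewrite eqxx /incr_at eqxx addn1.
apply: (@le_trans _ _ (\sum_(j < q) (p%:R ^+ k i * (2 * p%:R ^+ 2 * q%:R ^+ 2) * t ^+ 2))).
  apply: ler_sum => j _; rewrite mul1r.
  have := @bump_taylor R p (k i) (q%:R * x 0 i - j%:R) (q%:R * t) kip.
  have -> : q%:R * x 0 i - j%:R + q%:R * t = q%:R * (x + t *: 'e_i) 0 i - j%:R.
    by rewrite !mxE !eqxx mulr1; ring.
  rewrite (mulrC q%:R t) => /le_trans; apply.
  by rewrite exprMn !exprSr; rewrite le_eqVlt; apply/orP; left; apply/eqP; ring.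
rewrite sumr_const card_ord -mulr_natl /B.
rewrite le_eqVlt; apply/orP; left; apply/eqP; ring.
Qed.

End wave.

(** * One-sided partial derivatives and continuity on the cube *)

Section cube_calculus.
Context {R : realType} {s : nat}.
Implicit Types (f g : 'rV[R]_s -> R) (x y : 'rV[R]_s) (i : 'I_s).

(** From any point of the cube one can move by up to 1/2 along each axis, in one
    of the two directions, without leaving the cube. *)
Lemma cube_incr_proper i x : cube x -> ProperFilter (cube_incr i x).
Proof.
move=> cx; apply: Build_ProperFilter_ex => P [].
rewrite /nbhs_ball_ /= => e e0 H.
have e2 : 0 < e / 2 by lra.
pose r := Num.min (e / 2) (1 / 2).
have r0 : 0 < r by rewrite lt_min e2 /=; lra.
have re : r < e by rewrite gt_min; apply/orP; left; lra.
have r2 : r <= 1 / 2 by rewrite ge_min lexx orbT.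
have cu t : - x 0 i <= t <= 1 - x 0 i -> cube (x + t *: 'e_i).
  move=> /andP[t0 t1] i'; rewrite !mxE eqxx /=; case: eqP => [->|_].
    by rewrite mulr1; apply/andP; split; lra.
  by rewrite mulr0 addr0 cx.
have /andP[x0 x1] := cx i.
have [t [t0 tr tc]] : exists t, [/\ t != 0, `|t| = r & cube (x + t *: 'e_i)].
  case: (lerP (x 0 i) (1 / 2)) => xi.
    exists r; split; [by rewrite gt_eqF|by rewrite gtr0_norm|].
    by apply: cu; apply/andP; split; lra.
  exists (- r); split; [by rewrite oppr_eq0 gt_eqF|by rewrite normrN gtr0_norm|].
  by apply: cu; apply/andP; split; lra.
exists t; apply: H => //=.
by rewrite sub0r normrN tr.
Qed.

Lemma diff_quot_cvg i f g a C x : cube x -> {in @cube R s, f =1 g} -> 0 <= C ->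
  (forall t, `|g (x + t *: 'e_i) - g x - t * a| <= C * t ^+ 2) ->
  diff_quot i f x t @[t --> cube_incr i x] --> a.
Proof.
move=> cx fg C0 gC; have := cube_incr_proper i cx => PF.
apply/cvgrPdist_le => e e0.
rewrite /cube_incr near_withinE /dnbhs near_withinE.
have eC : 0 < e / (C + 1) by rewrite divr_gt0 //; lra.
exists (e / (C + 1)) => //= t; rewrite /ball_ /= sub0r normrN => te t0 ct.
rewrite /diff_quot !fg ?inE //.
have tn : 0 < `|t| by rewrite normr_gt0.
rewrite distrC.
have -> : t^-1 * (g (x + t *: 'e_i) - g x) - a =
    t^-1 * (g (x + t *: 'e_i) - g x - t * a).
  by rewrite [RHS]mulrBr mulKf.
rewrite normrM normfV ler_pdivrMl //; apply: (le_trans (gC t)).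
rewrite -real_normK ?num_real // expr2 mulrCA ler_pM2l //.
move: te; rewrite ltr_pdivlMr; last lra.
nra.
Qed.

Lemma cube_derivable_taylor i f g a C x : cube x -> {in @cube R s, f =1 g} -> 0 <= C ->
  (forall t, `|g (x + t *: 'e_i) - g x - t * a| <= C * t ^+ 2) ->
  cube_derivable i f x /\ cube_partial i f x = a.
Proof.
move=> cx fg C0 gC; have PF := cube_incr_proper i cx.
have fa := diff_quot_cvg cx fg C0 gC.
by split; [exact: cvgP fa|exact: cvg_lim fa].
Qed.

Lemma cube_lipschitz_continuous f g K : {in @cube R s, f =1 g} -> 0 <= K ->
  (forall x y, `|g x - g y| <= K * \sum_i `|x 0 i - y 0 i|) ->
  {within @cube R s, continuous f}.
Proof.
move=> fg K0 gK; apply: (@subspace_eq_continuous _ _ _ g).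
  by move=> x xc; apply/esym/fg.
apply: continuous_subspaceT => x; apply/(@cvgrPdist_le _ _ _ _ (nbhs_filter x)) => e e0.
have eK : 0 < e / (K * s%:R + 1).
  by rewrite divr_gt0 // ltr_pwDr // mulr_ge0.
near=> y; apply: (le_trans (gK x y)).
have xy : `|x - y| <= e / (K * s%:R + 1).
  by near: y; apply: cvgr_dist_le => //; exact: cvg_id.
apply: (@le_trans _ _ (K * \sum_(i < s) (e / (K * s%:R + 1)))).
  rewrite ler_wpM2l //; apply: ler_sum => i _; apply: le_trans xy.
  rewrite [leRHS]/Num.norm /= mx_normrE (le_trans _ (le_bigmax _ _ (0, i))) //=.
  by rewrite !mxE.
have D0 : 0 < K * s%:R + 1 by rewrite ltr_pwDr // mulr_ge0.
rewrite sumr_const card_ord -[_ *+ s](mulr_natl (e / _)).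
set D := K * s%:R + 1 in D0 *.
have -> : K * (s%:R * (e / D)) = e * (K * s%:R / D) by ring.
by rewrite ler_piMr ?(ltW e0) // ler_pdivrMr // mul1r lerDl.
Unshelve. all: by end_near. Qed.

Lemma sum_norm_le_eucl x : \sum_i `|x 0 i| <= Num.sqrt s%:R * eucl_norm x.
Proof.
rewrite /eucl_norm -sqrtrM // -[leLHS]ger0_norm ?sumr_ge0 // -sqrtr_sqr.
apply: ler_wsqrtr.
have := cauchy_schwarz_sum (fun=> 1) (fun i => `|x 0 i|).
under eq_bigr do rewrite mul1r.
under [X in _ <= X * _ -> _]eq_bigr do rewrite expr1n.
under [X in _ <= _ * X -> _]eq_bigr do rewrite real_normK ?num_real //.
by rewrite sumr_const card_ord.
Qed.

Lemma eucl_norm_gt0 x : x != 0 -> 0 < eucl_norm x.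
Proof.
move=> x0; rewrite sqrtr_gt0 lt_neqAle sumr_ge0 ?andbT => [|i _]; last exact: sqr_ge0.
apply: contra x0; rewrite eq_sym psumr_eq0 => [/allP H|i _]; last exact: sqr_ge0.
apply/eqP/rowP => i; rewrite mxE; apply/eqP; rewrite -sqrf_eq0.
by apply: (implyP (H i _)); rewrite ?mem_index_enum.
Qed.

End cube_calculus.

(** * The sums of bumps are in the smoothness class *)

Lemma smooth_orderP (R : realType) (l : R) : 0 < l ->
  (smooth_order l)%:R < l <= (smooth_order l).+1%:R.
Proof.
move=> l0; rewrite /smooth_order; set c := Num.ceil l.
have c0 : 0 < c by rewrite -ceil_gt0 in l0 *.
have cE : `|c|%N.-1.+1%:R = c%:~R :> R.
  by rewrite prednK ?absz_gt0 ?gt_eqF // natr_absz gtr0_norm.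
have := ceil_itv l; rewrite -/c => /andP[c1 c2].
rewrite cE c2 andbT; apply: le_lt_trans c1.
by rewrite intrB -cE -natr1; lra.
Qed.

Lemma smooth_order_le_truncn (R : realType) (l : R) : 0 < l ->
  (smooth_order l <= Num.truncn l)%N.
Proof.
by move=> l0; have /andP[ml _] := smooth_orderP l0; rewrite truncn_ge_nat ltW.
Qed.

Section wave_class.
Context {R : realType} {s q p : nat}.
Variable sg : {ffun {ffun 'I_s -> 'I_q} -> bool}.
Hypothesis (s0 : (0 < s)%N).
Variable A : R.

Let h : 'rV[R]_s -> R := fun x => A * wave p sg (fun=> 0%N) x.

Definition letter_count (w : seq 'I_s) : 'I_s -> nat := fun i => count_mem i w.

Lemma sum_letter_count w : (\sum_i letter_count w i)%N = size w.
Proof.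
elim: w => [|i w IH]; first by rewrite big1.
rewrite /= /letter_count /= big_split /= [X in (_ + X)%N]IH.
by rewrite (bigD1 i) //= eqxx big1 ?addn0 // => i' /negbTE; rewrite eq_sym => ->.
Qed.

Lemma letter_count_le w i : (letter_count w i <= size w)%N.
Proof. exact: count_size. Qed.

Let scaled w x := A * q%:R ^+ size w * wave p sg (letter_count w) x.

Lemma wave_partial i w x : ((size w).+1 < p)%N -> cube x ->
  {in @cube R s, cube_partials w h =1 scaled w} ->
  cube_derivable i (cube_partials w h) x /\
    cube_partial i (cube_partials w h) x = scaled (i :: w) x.
Proof.
move=> wp cx hw.
have kp i' : (letter_count w i' < p)%N.
  exact: leq_ltn_trans (letter_count_le w i') (ltnW wp).
have kip : ((letter_count w i).+1 < p)%N.
  by apply: leq_ltn_trans wp; rewrite ltnS letter_count_le.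
have [C C0 CP] := wave_taylor (R := R) sg kp kip.
pose B := A * q%:R ^+ size w.
apply: (@cube_derivable_taylor _ _ _ _ (scaled w) _ (`|B| * C)) => //.
  by rewrite mulr_ge0.
move=> t; rewrite -mulrA /scaled -/B.
have -> : wave p sg (letter_count (i :: w)) x = wave p sg (incr_at i (letter_count w)) x.
  by apply: wave_eq => // i'; rewrite /letter_count /incr_at /= eq_sym addnC.
set W1 := wave _ _ _ (x + _); set W0 := wave _ _ _ x; set W' := wave _ _ _ x.
have -> : B * W1 - B * W0 - t * (A * q%:R ^+ size (i :: w) * W') =
    B * (W1 - W0 - t * q%:R * W') by rewrite /B /= exprS; ring.
by rewrite normrM ler_wpM2l //; exact: CP.
Qed.

Lemma wave_partials w : (size w < p)%N ->
  {in @cube R s, cube_partials w h =1 scaled w}.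
Proof.
elim: w => [_ x _|i w IH wp x]; first by rewrite /scaled expr0 mulr1.
by rewrite inE => cx; have [_] := wave_partial i wp cx (IH (ltnW wp)).
Qed.

Lemma scaled_lip w x y : (size w < p)%N ->
  `|scaled w x - scaled w y| <=
    `|A * q%:R ^+ size w| * (p%:R ^+ (size w).+1 * q%:R) * \sum_i `|x 0 i - y 0 i|.
Proof.
move=> wp; rewrite -mulrBr normrM -mulrA ler_wpM2l // -(sum_letter_count w).
by apply: wave_lip => i; exact: leq_ltn_trans (letter_count_le w i) wp.
Qed.

Lemma wave_Cm m : (m < p)%N -> cube_Cm m h.
Proof.
move=> mp; split=> [w wm i x cx|w wm].
  have wp := leq_ltn_trans wm mp.
  by have [] := wave_partial i wp cx (wave_partials (ltnW wp)).
have wp := leq_ltn_trans wm mp.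
apply: (cube_lipschitz_continuous (wave_partials wp)); last first.
  by move=> x y; exact: scaled_lip.
by rewrite !mulr_ge0 ?exprn_ge0.
Qed.

Lemma scaled_le w x : (size w < p)%N ->
  `|scaled w x| <= `|A * q%:R ^+ size w| * (p%:R ^+ size w / 4).
Proof.
move=> wp; rewrite normrM ler_wpM2l // -(sum_letter_count w).
by apply: wave_le => // i; exact: leq_ltn_trans (letter_count_le w i) wp.
Qed.

End wave_class.

(** In the Hölder condition only [min 1 u <= u `^ alpha] is needed, with
    [u = q * |x - y|]: the oscillation of a derivative of order [m] is at most
    [q `^ (- alpha)] times the left-hand side. *)
Lemma wave_Lambda (R : realType) (l : R) (s q : nat)
    (sg : {ffun {ffun 'I_s -> 'I_q} -> bool}) : 0 < l -> (0 < s)%N -> (0 < q)%N ->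
  let p := (Num.truncn l).+1 in
  Lambda l s (fun x =>
    (Num.sqrt s%:R * p%:R ^+ p)^-1 / q%:R `^ l * wave p sg (fun=> 0%N) x).
Proof.
move=> l0 s0 q0 p; set A := _^-1 / _; set m := smooth_order l.
have /andP[ml lm] := smooth_orderP l0; rewrite -/m in ml lm.
have mp : (m < p)%N by rewrite ltnS smooth_order_le_truncn.
have q1 : 1 <= q%:R :> R by rewrite ler1n.
have p1 : 1 <= p%:R :> R by rewrite ler1n.
have s1 : 1 <= Num.sqrt s%:R :> R by rewrite -[X in X <= _]sqrtr1 ler_wsqrtr // ler1n.
pose S : R := Num.sqrt s%:R * p%:R ^+ p.
have S0 : 0 < S by rewrite mulr_gt0 ?exprn_gt0 //; lra.
have ql0 : 0 < q%:R `^ l by rewrite powR_gt0 //; lra.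
have A0 : 0 < A by rewrite divr_gt0 ?invr_gt0.
have AqE w : `|A * q%:R ^+ w| = S^-1 * (q%:R ^+ w / q%:R `^ l).
  by rewrite ger0_norm ?mulr_ge0 ?exprn_ge0 ?(ltW A0) // /A -/S; ring.
have pS w : (w <= p)%N -> p%:R ^+ w <= S.
  move=> wp; apply: (@le_trans _ _ (1 * p%:R ^+ p)).
    by rewrite mul1r ler_weXn2l.
  by rewrite ler_wpM2r // exprn_ge0.
split.
- exact: wave_Cm.
- move=> w wm; apply: ge_ereal_sup => _ [x cx <-].
  have wp := leq_ltn_trans wm mp.
  rewrite lee_fin (wave_partials sg A wp) ?inE //; apply: (le_trans (scaled_le sg s0 A x wp)).
  rewrite AqE mulrAC mulrA -mulrA.
  have h1 : q%:R ^+ size w / q%:R `^ l <= 1.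
    rewrite ler_pdivrMr // mul1r -powR_mulrn ?ler0n // ler_powR //.
    by apply: le_trans (ltW ml); rewrite ler_nat.
  have h2 : S^-1 * (p%:R ^+ size w / 4) <= 1.
    rewrite ler_pdivrMl // mulr1; have := pS _ (ltnW wp).
    have := exprn_ge0 (size w) (ler0n R p); lra.
  have h3 : 0 <= S^-1 * (p%:R ^+ size w / 4).
    by rewrite !mulr_ge0 ?invr_ge0 ?exprn_ge0 // ltW.
  have h4 : 0 <= q%:R ^+ size w / q%:R `^ l by rewrite divr_ge0 ?exprn_ge0 // ltW.
  nra.
move=> w wm; apply: ge_ereal_sup => _ [x [y [cx cy xy ->]]].
have wp : (size w < p)%N by rewrite wm.
rewrite lee_fin !(wave_partials sg A wp) ?inE //.
set T := eucl_norm (x - y); have T0 : 0 < T by rewrite eucl_norm_gt0 // subr_eq0; exact/eqP.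
have Ta0 : 0 < T `^ (l - m%:R) by rewrite powR_gt0.
rewrite ler_pdivrMr // mul1r.
set a := l - m%:R; have a0 : 0 < a by rewrite subr_gt0.
have a1 : a <= 1 by rewrite /a; move: lm; rewrite -natr1; lra.
have qa0 : 0 < q%:R `^ a by rewrite powR_gt0 //; lra.
have AmE : `|A * q%:R ^+ m| = S^-1 / q%:R `^ a.
  rewrite AqE; congr (_ * _).
  have -> : l = m%:R + a by rewrite /a; ring.
  rewrite powRD ?powR_mulrn ?ler0n //; last by apply/implyP => _; rewrite gt_eqF //; lra.
  by rewrite invfM mulrA divff ?mul1r // gt_eqF // exprn_gt0 //; lra.
have u0 : 0 < q%:R * T by rewrite mulr_gt0 //; lra.
apply: (@le_trans _ _ ((q%:R `^ a)^-1 * Num.min 1 (q%:R * T))); last first.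
  rewrite ler_pdivrMl // -powRM ?(ltW T0) //; case: (lerP 1 (q%:R * T)) => u1.
    apply: (@le_trans _ _ (1 `^ a)); first by rewrite powR1.
    by rewrite ge0_ler_powR ?nnegrE ?(ltW a0) ?(ltW u0).
  by apply: ger1_powR => //; rewrite u0 ltW.
have Si0 : 0 < S^-1 by rewrite invr_gt0.
have qi0 : 0 < (q%:R `^ a)^-1 by rewrite invr_gt0.
rewrite minr_pMr ?(ltW qi0) // le_min; apply/andP; split.
  rewrite mulr1; apply: (le_trans (ler_normB _ _)).
  have := scaled_le sg s0 A x wp; have := scaled_le sg s0 A y wp.
  rewrite wm AmE => hx hy.
  apply: (le_trans (lerD hy hx)).
  have h2 : S^-1 * p%:R ^+ m <= 1 by rewrite ler_pdivrMl // mulr1 pS // ltnW.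
  have h3 : 0 <= S^-1 * p%:R ^+ m by rewrite mulr_ge0 ?exprn_ge0 // ltW.
  have -> : S^-1 / q%:R `^ a * (p%:R ^+ m / 4) + S^-1 / q%:R `^ a * (p%:R ^+ m / 4) =
    (q%:R `^ a)^-1 * ((S^-1 * p%:R ^+ m) / 2) by field; rewrite ?gt_eqF.
  by rewrite -[leRHS]mulr1 ler_pM2l //; lra.
apply: (le_trans (scaled_lip sg A x y wp)); rewrite wm AmE.
have xyT : \sum_i `|x 0 i - y 0 i| <= Num.sqrt s%:R * T.
  by have := sum_norm_le_eucl (x - y); under eq_bigr do rewrite !mxE.
apply: (@le_trans _ _ (S^-1 / q%:R `^ a * (p%:R ^+ m.+1 * q%:R) * (Num.sqrt s%:R * T))).
  by rewrite ler_wpM2l // !mulr_ge0 ?exprn_ge0 // ltW.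
have h1 : S^-1 * (Num.sqrt s%:R * p%:R ^+ m.+1) <= 1.
  rewrite ler_pdivrMl // mulr1 ler_wpM2l ?ler_weXn2l //; lra.
have -> : S^-1 / q%:R `^ a * (p%:R ^+ m.+1 * q%:R) * (Num.sqrt s%:R * T) =
  (S^-1 * (Num.sqrt s%:R * p%:R ^+ m.+1)) * (q%:R * T / q%:R `^ a) by ring.
by rewrite [leRHS]mulrC ler_piMl // divr_ge0 // ltW.
Qed.

(** * The integral of the bump *)

Section bump_integral.
Context {R : realType}.

(** Integration by parts in polynomial form: [Q_(a, b.+1)] is
    [(bern a.+1 b.+1 + b.+1 Q_(a.+1, b)) / a.+1]. *)
Lemma bern_antiderivative a b : exists Q : {poly R},
  [/\ Q^`() = bern a b, Q.[0] = 0 & Q.[1] = (a`! * b`!)%:R / ((a + b).+1)`!%:R].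
Proof.
have nf (n : nat) : n.+1%:R != 0 :> R by rewrite pnatr_eq0.
have ff (n : nat) : n`!%:R != 0 :> R by rewrite pnatr_eq0 -lt0n fact_gt0.
elim: b a => [|b IH] a.
  exists (a.+1%:R^-1 *: 'X^(a.+1)); split.
  - rewrite derivZ derivXn -scalerMnr -[_ *: _ *+ _]scaler_nat scalerA mulfV //.
    by rewrite scale1r /bern expr0 mulr1.
  - by rewrite !hornerE expr0n mulr0.
  - rewrite addn0 muln1 hornerZ hornerXn expr1n mulr1 factS natrM.
    by rewrite invfM mulrCA divff // mulr1.
have [Q [dQ Q0 Q1]] := IH a.+1.
exists (a.+1%:R^-1 *: (bern a.+1 b.+1 + b.+1%:R *: Q)); split.
- rewrite derivZ derivD deriv_bern derivZ dQ subrK scalerA mulVf //.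
  by rewrite scale1r.
- by rewrite hornerZ hornerD hornerBern hornerZ Q0 expr0n mul0r mulr0 addr0 mulr0.
- rewrite hornerZ hornerD hornerBern hornerZ subrr expr0n /= mulr0 add0r Q1 addSn addnS.
  rewrite !factS !natrM; field.
  by rewrite ff -[1]/(1%:R) -!natrD !pnatr_eq0.
Qed.

Lemma measurable_bump p q j : measurable_fun [set: R]
  (fun x : R => bump_deriv p 0 (q%:R * x - j%:R)).
Proof.
have mc : measurable_fun [set: R] (fun x : R => clamp (q%:R * x - j%:R)).
  have mf : measurable_fun [set: R] (fun x : R => q%:R * x - j%:R).
    by apply: measurable_funB => //; apply: measurable_funM.
  exact: (measurable_maxr (measurable_cst (0 : R)) (measurable_minr (measurable_cst (1 : R)) mf)).
under eq_fun do rewrite bump0E.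
by apply: measurable_funX; apply: measurable_funM => //; apply: measurable_funB.
Qed.

Lemma bump_ge0 p x : 0 <= bump_deriv p 0 x :> R.
Proof. by rewrite bump0E exprn_ge0 // mulr_ge0 ?subr_ge0 ?clamp_ge0 ?clamp_le1. Qed.

Lemma poly_FTC2 (P : {poly R}) (a b : R) : a < b ->
  (\int[@lebesgue_measure R]_(x in `[a, b]) (P^`().[x])%:E = (P.[b] - P.[a])%:E)%E.
Proof.
move=> ab; rewrite (@continuous_FTC2 R (horner P^`()) (horner P)) //.
- by apply: continuous_subspaceT; exact: continuous_horner.
- split => [x _||]; first exact: derivable_horner.
  + by apply: cvg_at_right_filter; exact: continuous_horner.
  + by apply: cvg_at_left_filter; exact: continuous_horner.
- by move=> x _; rewrite derive1E; apply: derive_val; exact: is_derive_poly.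
Qed.

Lemma bump_integral p q j : (0 < p)%N -> (0 < q)%N ->
  (\int[@lebesgue_measure R]_x (bump_deriv p 0 (q%:R * x - j%:R))%:E =
   ((p`! ^ 2)%:R / (2 * p + 1)`!%:R / q%:R)%:E)%E.
Proof.
move=> p0 q0; have q0' : 0 < q%:R :> R by rewrite ltr0n.
pose a : R := j%:R / q%:R; pose b : R := j.+1%:R / q%:R.
have ab : a < b by rewrite ltr_pM2r ?invr_gt0 // ltr_nat.
pose f x : \bar R := (bump_deriv p 0 (q%:R * x - j%:R))%:E.
have inab x : (x \in `[a, b]) = (0 <= q%:R * x - j%:R <= 1).
  rewrite in_itv /= /a /b ler_pdivrMr // ler_pdivlMr // -natr1 (mulrC x).
  by rewrite subr_ge0 lerBlDr [_ + j%:R]addrC.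
have fE : f = f \_ `[a, b].
  apply/funext => x; rewrite patchE; case: ifPn => // xab; rewrite /f bump_out //.
  move: xab; rewrite notin_setE /= inab => /negP; rewrite negb_and -!ltNge.
  by case/orP => /ltW; [left|right].
rewrite -[LHS]/(\int[lebesgue_measure]_x f x)%E fE -integral_mkcond.
have [Q [dQ Q0 Q1]] := bern_antiderivative p p.
pose P := q%:R^-1 *: (Q \Po (q%:R *: 'X - j%:R%:P)).
have PE x : P.[x] = q%:R^-1 * Q.[q%:R * x - j%:R].
  by rewrite /P hornerZ horner_comp !hornerE.
transitivity (\int[@lebesgue_measure R]_(x in `[a, b]) (P^`().[x])%:E)%E.
  apply: eq_integral => x; rewrite inE /= inab => xab.
  rewrite /f /bump_deriv derivn0 clamp_id // -dQ /P derivZ deriv_comp.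
  rewrite derivB derivZ derivX derivC subr0 hornerZ hornerM horner_comp !hornerE.
  set Z := Q^`().[_]; congr EFin; rewrite -[RHS]/(q%:R^-1 * Z * q%:R * 1).
  by field; rewrite gt_eqF.
rewrite poly_FTC2 // !PE /a /b !(mulrC q%:R) !divfK ?gt_eqF // subrr Q0 mulr0 subr0.
rewrite -natr1 [_ + 1]addrC addrK Q1 mulrC; congr (_%:R / _`!%:R / _)%:E; lia.
Qed.

(** Tonelli's theorem, one coordinate at a time. *)
Lemma tuple_integral_prod s (g : 'I_s -> R -> R) :
  (forall i, measurable_fun [set: R] (g i)) -> (forall i x, 0 <= g i x) ->
  (\int[lebesgue_tuple s]_t (\prod_i g i (tnth t i))%:E =
   \prod_i \int[@lebesgue_measure R]_x (g i x)%:E)%E.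
Proof.
elim: s g => [|s IH] g mg g0.
  under eq_integral do rewrite big_ord0.
  by rewrite big_ord0 /= integral_dirac // diracE mem_set // mul1e.
have mprod s' (g' : 'I_s' -> R -> R) : (forall i, measurable_fun [set: R] (g' i)) ->
  measurable_fun [set: s'.-tuple (measurableTypeR R)] (fun t => (\prod_i g' i (tnth t i))%:E).
  move=> mg'; apply/measurable_EFinP; apply: measurable_prod => i _.
  by apply: (measurableT_comp (mg' i)); exact: measurable_tnth.
rewrite /= ge0_integral_pushforward //; last 3 first.
- exact: measurable_tcons.
- exact: mprod.
- by move=> t _; rewrite lee_fin prodr_ge0.
rewrite preimage_setT fubini_tonelli1; last 2 first.
- apply: (measurableT_comp (mprod _ _ mg)); exact: measurable_tcons.
- by move=> t; rewrite lee_fin prodr_ge0.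
rewrite big_ord_recl -IH; last 2 first.
- by move=> i; exact: mg.
- by move=> i x; exact: g0.
rewrite -ge0_integralZr //; last 3 first.
- by apply/measurable_EFinP; exact: mg.
- by move=> x _; rewrite lee_fin.
- by apply: integral_ge0 => t _; rewrite lee_fin prodr_ge0.
apply: eq_integral => x _; rewrite /fubini_F /=.
rewrite -ge0_integralZl_EFin //; last 2 first.
- by move=> t _; rewrite lee_fin prodr_ge0.
- exact: (mprod s (fun i => g (lift ord0 i)) (fun i => mg _)).
apply: eq_integral => t _; rewrite -EFinM; congr EFin.
by rewrite big_ord_recl; congr (_ * _); apply: eq_bigr => i _; rewrite tnthS.
Qed.

End bump_integral.

(** * Cells *)

Lemma wave_cell (R : realType) (s q p : nat)
    (sg : {ffun {ffun 'I_s -> 'I_q} -> bool}) (j : {ffun 'I_s -> 'I_q}) (x : 'rV[R]_s) :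
  (0 < p)%N -> (forall i, (j i)%:R <= q%:R * x 0 i <= (j i).+1%:R) ->
  wave p sg (fun=> 0%N) x =
    (-1) ^+ sg j * \prod_i bump_deriv p 0 (q%:R * x 0 i - (j i)%:R).
Proof.
move=> p0 xj; rewrite /wave /tensor_sum (bigD1 j) //= [X in _ + X]big1 ?addr0 // => j' j'j.
have /existsP[i j'i] : [exists i, j' i != j i].
  apply/existsPn => H; case/eqP: j'j; apply/ffunP => i.
  by apply/eqP; rewrite -[_ == _]negbK H.
rewrite (bigD1 i) //= bump_out ?mul0r ?mulr0 //.
have /andP[x0 x1] := xj i.
have [lt|gt|/ord_inj e] := ltngtP (j' i) (j i); last by rewrite e eqxx in j'i.
- right; have : (j' i).+1%:R <= (j i)%:R :> R by rewrite ler_nat.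
  by rewrite -natr1; lra.
- left; have : (j i).+1%:R <= (j' i)%:R :> R by rewrite ler_nat.
  by rewrite -natr1; lra.
Qed.

Section L1_cells.
Context {R : realType} {s q : nat}.
Hypothesis q0 : (0 < q)%N.
Local Notation mu := (@lebesgue_tuple R s).
Local Notation row := (@row_of_tuple R s).
Local Notation D := (@row_of_tuple R s @^-1` @cube R s).
Implicit Types (j : {ffun 'I_s -> 'I_q}) (u : 'rV[R]_s -> R).

(** Half-open, so that the cells are disjoint. *)
Definition cell j : set (s.-tuple (measurableTypeR R)) :=
  [set t | forall i, (j i)%:R <= q%:R * tnth t i < (j i).+1%:R].

Let q0R : 0 < q%:R :> R. Proof. by rewrite ltr0n. Qed.

Lemma measurable_box (A : 'I_s -> set (measurableTypeR R)) :
  (forall i, measurable (A i)) ->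
  measurable [set t : s.-tuple (measurableTypeR R) | forall i, A i (tnth t i)].
Proof.
move=> mA.
have -> : [set t : s.-tuple (measurableTypeR R) | forall i, A i (tnth t i)] =
    \bigcap_(i in setT) ((@tnth s (measurableTypeR R) ^~ i) @^-1` A i).
  by apply/seteqP; split => t h i; [move=> _; exact: h|exact: (h i)].
apply: fin_bigcap_measurable => [|i _]; first exact: finite_finset.
by rewrite -[X in measurable X]setTI; exact: measurable_tnth.
Qed.

Lemma measurable_cell j : measurable (cell j).
Proof.
have -> : cell j = [set t | forall i, `[(j i)%:R / q%:R, (j i).+1%:R / q%:R[%classic (tnth t i)].
  apply/seteqP; split => t H i; have := H i; rewrite /= in_itv /= ler_pdivrMr // ltr_pdivlMr //;
  by rewrite (mulrC q%:R).
exact: (@measurable_box (fun i => `[(j i)%:R / q%:R, (j i).+1%:R / q%:R[%classic)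
  (fun i => measurable_itv _)).
Qed.

Lemma measurable_cube_tuple : measurable D.
Proof.
have -> : D = [set t | forall i, `[0, 1]%classic (tnth t i)].
  by apply/seteqP; split => t H i; have := H i; rewrite /= in_itv /= mxE.
exact: (@measurable_box (fun=> `[0, 1]%classic) (fun=> measurable_itv _)).
Qed.

Lemma cell_sub_cube j : cell j `<=` D.
Proof.
move=> t tj i; have /andP[t0 t1] := tj i; rewrite mxE; apply/andP; split.
  by rewrite -(pmulr_rge0 _ q0R); apply: le_trans t0.
rewrite -(ler_pM2l q0R) mulr1; apply: (le_trans (ltW t1)).
by rewrite ler_nat ltn_ord.
Qed.

Lemma trivIset_cell (A : set {ffun 'I_s -> 'I_q}) : trivIset A cell.
Proof.
move=> j j' _ _ [t [tj tj']]; apply/ffunP => i; apply/ord_inj.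
have /andP[a0 a1] := tj i; have /andP[b0 b1] := tj' i.
apply/eqP; rewrite eqn_leq; apply/andP; split; rewrite -ltnS -(ltr_nat R).
  exact: le_lt_trans a0 b1.
exact: le_lt_trans b0 a1.
Qed.

Lemma L1_norm_cells u : L1_space R s u ->
  (\sum_j `|\int[mu]_(t in cell j) (u (row t))%:E| <= L1_norm u)%E.
Proof.
move=> iu; have mu_ := measurable_int _ iu.
have mcell j : measurable_fun (cell j) (fun t => (u (row t))%:E).
  exact: measurable_funS measurable_cube_tuple (@cell_sub_cube j) mu_.
apply: (@le_trans _ _ (\sum_j \int[mu]_(t in cell j) `|(u (row t))%:E|)%E).
  by apply: lee_sum => j _; apply: le_abse_integral => //; exact: measurable_cell.
have sub : \big[setU/set0]_(j <- index_enum {ffun 'I_s -> 'I_q}) cell j `<=` D.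
  by rewrite -bigcup_seq => t [j _]; exact: cell_sub_cube.
have mabs : measurable_fun D (fun t => `|(u (row t))%:E|)%E by exact: measurableT_comp.
rewrite -(@ge0_integral_bigsetU _ _ _ _ _ cell _ (index_enum _)).
- apply: ge0_subset_integral => //.
  + by apply: bigsetU_measurable => j _; exact: measurable_cell.
  + exact: measurable_cube_tuple.
- exact: measurable_cell.
- exact: index_enum_uniq.
- exact: trivIset_cell.
- apply: measurable_funS measurable_cube_tuple sub mabs.
- by [].
Qed.

Variable p : nat.
Hypothesis p0 : (0 < p)%N.

Let phi j (t : s.-tuple (measurableTypeR R)) : R :=
  \prod_i bump_deriv p 0 (q%:R * tnth t i - (j i)%:R).

Definition bump_mass : R := (p`! ^ 2)%:R / (2 * p + 1)`!%:R / q%:R.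

Lemma phi_ge0 j t : 0 <= phi j t.
Proof. by apply: prodr_ge0 => i _; exact: bump_ge0. Qed.

Lemma measurable_phi j : measurable_fun setT (phi j).
Proof.
apply: measurable_prod => i _.
by apply: (measurableT_comp (measurable_bump p q (j i))); exact: measurable_tnth.
Qed.

Lemma phi_integral j : (\int[mu]_t (phi j t)%:E = (bump_mass ^+ s)%:E)%E.
Proof.
rewrite (tuple_integral_prod (g := fun i x => bump_deriv p 0 (q%:R * x - (j i)%:R))).
- under eq_bigr do rewrite bump_integral //.
  by rewrite prodEFin prodr_const card_ord.
- by move=> i; exact: measurable_bump.
- by move=> i x; exact: bump_ge0.
Qed.

Lemma phi_cell_integral j :
  (\int[mu]_(t in cell j) (phi j t)%:E = (bump_mass ^+ s)%:E)%E.
Proof.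
rewrite -(phi_integral j) integral_mkcond; apply: eq_integral => t _.
rewrite patchE; case: ifPn => //; rewrite notin_setE => tj.
have /existsNP[i /negP ti] : ~ forall i, (j i)%:R <= q%:R * tnth t i < (j i).+1%:R by [].
rewrite /phi (bigD1 i) //= bump_out ?mul0r //.
move: ti; rewrite negb_and -ltNge -leNgt -natr1 => /orP[] ti; [left|right]; lra.
Qed.

Lemma phi_integrable j : mu.-integrable setT (fun t => (phi j t)%:E).
Proof.
apply/integrableP; split; first by apply/measurable_EFinP; exact: measurable_phi.
under eq_integral do rewrite gee0_abs ?lee_fin ?phi_ge0 //.
by rewrite phi_integral ltry.
Qed.

Lemma wave_L1 (sg : {ffun {ffun 'I_s -> 'I_q} -> bool}) : L1_space R s (wave p sg (fun=> 0%N)).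
Proof.
apply: (@integrableS _ _ _ _ setT) => //; first exact: measurable_cube_tuple.
have -> : (fun t => (wave p sg (fun=> 0%N) (row t))%:E) =
    (fun t => \sum_j (((-1) ^+ sg j)%:E * (phi j t)%:E))%E.
  apply/funext => t; rewrite /wave /tensor_sum -sumEFin; apply: eq_bigr => j _.
  rewrite EFinM; congr (_ * _%:E)%E; apply: eq_bigr => i _.
  by rewrite mxE.
apply: integrable_sum => // j _.
by apply: integrableZl => //; exact: phi_integrable.
Qed.

End L1_cells.

(** * Lower bounds for signed sums of bumps *)

Lemma poly_le_map (R : realType) (n d : nat) (b : {ffun 'I_n -> 'I_d.+1} -> R) :
  poly_le d (fun z : 'rV[R]_n =>
    \sum_(k : {ffun 'I_n -> 'I_d.+1} | (\sum_i k i <= d)%N)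
      b k * \prod_i z 0 i ^+ k i).
Proof. by apply: poly_le_sum => k kd; exact: (poly_le_monom (b k) kd). Qed.

Section lower_bounds.
Context {R : realType} {s n d q p : nat}.
Hypotheses (n1 : (1 <= n)%N) (d2 : (2 <= d)%N) (p0 : (0 < p)%N) (q0 : (0 < q)%N).
Hypothesis grid : 16 * (n%:R * log2 d%:R) <= (q ^ s)%:R :> R.
Variable A : R.
Hypothesis A0 : 0 < A.

Let h (sg : {ffun {ffun 'I_s -> 'I_q} -> bool}) : 'rV[R]_s -> R :=
  fun x => A * wave p sg (fun=> 0%N) x.

Let card_cells : #|{ffun 'I_s -> 'I_q}| = (q ^ s)%N.
Proof. by rewrite card_ffun !card_ord. Qed.

Lemma sup_norm_lower P : poly_maps (continuous_space R s) n d P ->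
  exists sg, forall zeta, ((A / 4 ^+ (p * s) / 3)%:E <= sup_norm (h sg \- P zeta)%R)%E.
Proof.
move=> [c _ ->].
pose ctr (j : {ffun 'I_s -> 'I_q}) : 'rV[R]_s := \row_i (((j i)%:R + 1 / 2) / q%:R).
have q0R : 0 < q%:R :> R by rewrite ltr0n.
have qctr j i : q%:R * ctr j 0 i = (j i)%:R + 1 / 2.
  by rewrite mxE mulrC divfK // gt_eqF.
have cube_ctr j : cube (ctr j).
  move=> i; rewrite mxE; apply/andP; split.
    by rewrite divr_ge0 ?addr_ge0.
  rewrite ler_pdivrMr // mul1r.
  have : (j i).+1%:R <= q%:R :> R by rewrite ler_nat.
  by rewrite -natr1; lra.
pose B := A / 4 ^+ (p * s).
have B0 : 0 < B by rewrite divr_gt0 // exprn_gt0.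
have hctr sg j : h sg (ctr j) = B * (-1) ^+ sg j.
  rewrite /h (wave_cell sg p0 (j := j)) => [|i]; last first.
    by rewrite qctr -(natr1 (j i)); apply/andP; split; lra.
  rewrite (eq_bigr (fun=> 4^-1 ^+ p)) => [|i _].
    by rewrite prodr_const card_ord -exprM exprVn mulrA mulrAC.
  rewrite qctr bump0E clamp_id; last by apply/andP; split; lra.
  by congr (_ ^+ _); field.
pose F j (z : 'rV[R]_n) := \sum_(k : {ffun 'I_n -> 'I_d.+1} | (\sum_i k i <= d)%N)
  (B^-1 * c k (ctr j)) * \prod_i z 0 i ^+ k i.
have FE j z : poly_map c z (ctr j) = B * F j z.
  rewrite /F /poly_map mulr_sumr; apply: eq_bigr => k _.
  by rewrite !mulrA divff ?mul1r // gt_eqF.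
have [sg sgP] : exists sg : {ffun {ffun 'I_s -> 'I_q} -> bool}, forall z,
    (exists j, 1 / 3 < `|(-1) ^+ sg j - F j z|) /\
    #|{ffun 'I_s -> 'I_q}|%:R / 30 < \sum_j `|(-1) ^+ sg j - F j z|.
  by apply: unreachable_signs n1 d2 (fun j => poly_le_map _) _; rewrite card_cells.
exists sg => z; have [[j jP] _] := sgP z.
apply: (@le_trans _ _ `|(h sg \- poly_map c z)%R (ctr j)|%:E).
  rewrite lee_fin /= hctr FE -mulrBr normrM gtr0_norm // -/B.
  by rewrite ler_pM2l // ltW //; move: jP; rewrite mul1r.
by apply: ereal_sup_ubound; exists (ctr j).
Qed.

Lemma L1_norm_lower P : poly_maps (L1_space R s) n d P ->
  exists sg, forall zeta,
    ((A * ((p`! ^ 2)%:R / (2 * p + 1)`!%:R) ^+ s / 30)%:E <= L1_norm (h sg \- P zeta)%R)%E.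
Proof.
move=> [c cL ->].
have q0R : 0 < q%:R :> R by rewrite ltr0n.
pose mu := lebesgue_tuple (R := R) s.
pose row := row_of_tuple (R := R) (s := s).
(* The coefficients of degree above [d] need not be integrable; they do not enter
   [poly_map], and 0 may replace them. *)
pose c' (k : {ffun 'I_n -> 'I_d.+1}) : 'rV[R]_s -> R :=
  if (\sum_i k i <= d)%N then c k else cst 0.
have c'L k : L1_space R s (c' k).
  rewrite /c'; case: ifP => [kd|_]; first exact: cL.
  exact: integrable0.
have cc' z : poly_map c z = fun x => \sum_k c' k x * (if (\sum_i k i <= d)%N then
    \prod_i z 0 i ^+ k i else 0).
  apply/funext => x; rewrite /poly_map big_mkcond; apply: eq_bigr => k _.
  by rewrite /c'; case: ifP => // _; rewrite mulr0.
pose M (j : {ffun 'I_s -> 'I_q}) k := fine (\int[mu]_(t in cell j) (c' k (row t))%:E)%E.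
pose beta : R := @bump_mass R q p ^+ s.
have m0 : 0 < @bump_mass R q p.
  by rewrite /bump_mass !divr_gt0 ?ltr0n ?expn_gt0 ?fact_gt0.
have beta0 : 0 < beta by rewrite exprn_gt0.
pose B := A * beta; have B0 : 0 < B by rewrite mulr_gt0.
pose F j (z : 'rV[R]_n) := \sum_(k : {ffun 'I_n -> 'I_d.+1} | (\sum_i k i <= d)%N)
  (B^-1 * M j k) * \prod_i z 0 i ^+ k i.
have cellI (u : 'rV[R]_s -> R) j : L1_space R s u ->
    mu.-integrable (@cell R s q j) (fun t => (u (row t))%:E).
  apply: integrableS; [exact: measurable_cube_tuple|exact: measurable_cell|exact: cell_sub_cube].
have PL z : L1_space R s (poly_map c z).
  rewrite cc' /L1_space /=; under eq_fun do rewrite -sumEFin.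
  apply: integrable_sum => [|k _]; first exact: measurable_cube_tuple.
  under eq_fun do rewrite mulrC EFinM.
  by apply: integrableZl; [exact: measurable_cube_tuple|exact: c'L].
have hL sg : L1_space R s (h sg).
  rewrite /L1_space /=; under eq_fun do rewrite EFinM.
  by apply: integrableZl; [exact: measurable_cube_tuple|exact: wave_L1].
have Pcell j z : (\int[mu]_(t in cell j) (poly_map c z (row t))%:E = (B * F j z)%:E)%E.
  rewrite cc'; under eq_integral do rewrite -sumEFin.
  rewrite integral_sum; [|exact: measurable_cell|move=> k]; last first.
    under eq_fun do rewrite mulrC EFinM.
    by apply: integrableZl; [exact: measurable_cell|exact: cellI].
  rewrite /F mulr_sumr -sumEFin [in RHS]big_mkcond; apply: eq_bigr => k _.
  under eq_integral do rewrite mulrC EFinM.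
  rewrite integralZl; [|exact: measurable_cell|exact: cellI].
  rewrite -[X in (_ * X)%E]fineK; last first.
    by apply: integrable_fin_num; [exact: measurable_cell|exact: cellI].
  rewrite -EFinM -/(M j k); case: ifP => _; last by rewrite mul0r.
  by congr EFin; rewrite !mulrA divff ?mul1r ?gt_eqF // mulrC.
have hcell sg j : (\int[mu]_(t in cell j) (h sg (row t))%:E = (B * (-1) ^+ sg j)%:E)%E.
  have hE (t : s.-tuple (measurableTypeR R)) : t \in cell j ->
     (h sg (row t))%:E = ((A * (-1) ^+ sg j)%:E *
       (\prod_i bump_deriv p 0 (q%:R * tnth t i - (j i)%:R))%:E)%E.
    rewrite inE => tj; rewrite -EFinM /h (wave_cell sg p0 (j := j)) => [|i].
      by rewrite mulrA; congr (_ * _)%:E; apply: eq_bigr => i _; rewrite mxE.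
    by rewrite mxE; have /andP[-> /ltW ->] := tj i.
  rewrite (eq_integral _ _ hE) integralZl; first last.
  - by apply: integrableS (phi_integrable q0 p0 j) => //; exact: measurable_cell.
  - exact: measurable_cell.
  by rewrite (phi_cell_integral q0 p0 j) -EFinM mulrAC.
have [sg sgP] : exists sg : {ffun {ffun 'I_s -> 'I_q} -> bool}, forall z,
    (exists j, 1 / 3 < `|(-1) ^+ sg j - F j z|) /\
    #|{ffun 'I_s -> 'I_q}|%:R / 30 < \sum_j `|(-1) ^+ sg j - F j z|.
  by apply: unreachable_signs n1 d2 (fun j => poly_le_map _) _; rewrite card_cells.
exists sg => z; have [_ jP] := sgP z.
have uL : L1_space R s (h sg \- poly_map c z).
  rewrite /L1_space /=; under eq_fun do rewrite EFinB.
  by apply: integrableB; [exact: measurable_cube_tuple|exact: hL|exact: PL].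
apply: le_trans (L1_norm_cells (q := q) q0 uL).
have -> : A * ((p`! ^ 2)%:R / (2 * p + 1)`!%:R) ^+ s / 30 = B * ((q ^ s)%:R / 30).
  rewrite /B /beta /bump_mass; move: (_ / (2 * p + 1)`!%:R) => X.
  have : q%:R ^+ s != 0 :> R by rewrite expf_neq0 // gt_eqF.
  rewrite expr_div_n (natrX _ q); move: (X ^+ s) (q%:R ^+ s) => Xs qs qs0.
  by field.
apply: (@le_trans _ _ (\sum_(j : {ffun 'I_s -> 'I_q}) B * `|(-1) ^+ sg j - F j z|)%:E).
  by rewrite lee_fin -mulr_sumr ler_pM2l // ltW // -card_cells.
rewrite -sumEFin; apply: lee_sum => j _.
under eq_integral do rewrite EFinB.
rewrite integralB; [|exact: measurable_cell|exact: cellI|exact: cellI].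
rewrite hcell Pcell -EFinB abse_EFin lee_fin.
by rewrite -mulrBr normrM gtr0_norm.
Qed.

End lower_bounds.

(** * Size of the grid and constants *)

Section constants.
Context {R : realType}.

Lemma grid_size (s : nat) (X : R) : (0 < s)%N -> 1 <= X ->
  exists q : nat, [/\ (0 < q)%N, 16 * X <= (q ^ s)%:R &
    q%:R <= 2 * (16 * X) `^ (s%:R^-1)].
Proof.
move=> s0 X1; set y := _ `^ _.
have y1 : 1 <= y.
  apply: (@le_trans _ _ (1 `^ s%:R^-1)); first by rewrite powR1.
  by rewrite ge0_ler_powR ?nnegrE ?invr_ge0 //; lra.
have y0 : 0 <= y by lra.
have /andP[yt ty] := truncn_itv y0.
exists (Num.truncn y).+1; split=> //; last by rewrite -natr1; lra.
rewrite natrX; apply: (@le_trans _ _ (y ^+ s)); last first.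
  by rewrite lerXn2r ?nnegrE // ltW.
rewrite -powR_mulrn // /y -powRrM mulVf ?powRr1 //; first lra.
by rewrite pnatr_eq0 -lt0n.
Qed.

(** Rounding [q] up costs a factor [2 `^ l], which is kept on the right; taking
    16 instead of 8 costs at most another [2 `^ l <= 2 ^ p], for which
    [(1 + e) ^ (s * p)], at least [3 ^ p], pays. *)
Lemma grid_power (s q : nat) (l X : R) : (0 < s)%N -> 1 <= X -> 0 < l ->
  q%:R <= 2 * (16 * X) `^ (s%:R^-1) ->
  3 * q%:R `^ l <= 2 * (2 `^ l * 8 `^ (l / s%:R) * X `^ (l / s%:R) *
    (1 + expR 1) ^+ (s * (Num.truncn l).+1)).
Proof.
move=> s0 X1 l0 qX; set p := (Num.truncn l).+1.
have s1 : 1 <= s%:R :> R by rewrite ler1n.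
have ls0 : 0 <= l / s%:R by rewrite divr_ge0 // ltW.
have ql : q%:R `^ l <= 2 `^ l * (2 `^ (l / s%:R) * (8 `^ (l / s%:R) * X `^ (l / s%:R))).
  rewrite -!powRM ?mulr_ge0 //; try lra.
  apply: (@le_trans _ _ ((2 * (16 * X) `^ s%:R^-1) `^ l)).
    by rewrite ge0_ler_powR ?nnegrE ?mulr_ge0 ?powR_ge0 // ltW.
  rewrite powRM ?powR_ge0 // -powRrM (mulrC _ l).
  by rewrite (_ : 16 * X = 2 * (8 * X)) //; ring.
have two : 3 * 2 `^ (l / s%:R) <= 2 * (1 + expR 1) ^+ (s * p).
  have lp : 2 `^ (l / s%:R) <= 2 ^+ p :> R.
    rewrite -powR_mulrn // ler_powR //; first lra.
    apply: (@le_trans _ _ l); first by rewrite ler_pdivrMr ?ltr0n // ler_peMr // ltW.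
    by have /andP[_ /ltW] := truncn_itv (ltW l0).
  have e3 : 3 <= 1 + expR 1 :> R by have := expR_ge1Dx (1 : R); lra.
  have ep : 3 ^+ p <= (1 + expR 1) ^+ (s * p) :> R.
    apply: (@le_trans _ _ ((1 + expR 1) ^+ p)).
      by rewrite lerXn2r ?nnegrE //; lra.
    by rewrite ler_weXn2l ?leq_pmull //; lra.
  have p23 : 3 * 2 ^+ p <= 2 * 3 ^+ p :> R.
    rewrite /p !exprS mulrCA ler_pM2l // ler_pM2l // lerXn2r ?nnegrE //; lra.
  lra.
apply: (@le_trans _ _ (3 * (2 `^ l * (2 `^ (l / s%:R) * (8 `^ (l / s%:R) * X `^ (l / s%:R)))))).
  by rewrite ler_pM2l.
have : 0 <= 2 `^ l * (8 `^ (l / s%:R) * X `^ (l / s%:R)) by rewrite !mulr_ge0 ?powR_ge0.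
move: two; move: (2 `^ l) (2 `^ (l / s%:R)) (8 `^ (l / s%:R)) (X `^ (l / s%:R)) (_ ^+ (s * p)).
by move=> a b c d e be acd; nra.
Qed.

Lemma width_bound_inf (l : R) (s n d q : nat) (p := (Num.truncn l).+1) :
  0 < l -> (0 < s)%N -> (0 < q)%N ->
  1 <= n%:R * log2 d%:R :> R ->
  q%:R <= 2 * (16 * (n%:R * log2 d%:R)) `^ (s%:R^-1) :> R ->
  width_bound (C_inf l s) l s n d <=
  (Num.sqrt s%:R * p%:R ^+ p)^-1 / q%:R `^ l / 4 ^+ (p * s) / 3.
Proof.
move=> l0 s0 q0 X1 qX; rewrite /width_bound /C_inf -/p.
have := grid_power s0 X1 l0 qX; rewrite -/p.
have qR : 0 < q%:R :> R by rewrite ltr0n.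
have X0 : 0 < (n%:R * log2 d%:R) `^ (l / s%:R) :> R by rewrite powR_gt0; lra.
have sR : 0 < Num.sqrt s%:R :> R by rewrite sqrtr_gt0 ltr0n.
have pR : 0 < p%:R ^+ p :> R by rewrite exprn_gt0 // ltr0n.
have ql0 : 0 < q%:R `^ l by rewrite powR_gt0.
have E8 : 0 < 8 `^ (l / s%:R) :> R by rewrite powR_gt0.
have E2 : 0 < 2 `^ l :> R by rewrite powR_gt0.
have -> : 2 `^ (l + 1) = 2 `^ l * 2 :> R.
  by rewrite powRD ?powRr1 //; apply/implyP.
have G0 : 0 < (1 + expR 1) ^+ (s * p) :> R.
  by rewrite exprn_gt0 // addr_gt0 ?expR_gt0.
have F0 : 0 < 4 ^+ (s * p) :> R by rewrite exprn_gt0.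
rewrite exprMn (mulnC p s).
move: (_ `^ _) X0 (Num.sqrt _) sR (p%:R ^+ p) pR (q%:R `^ l) ql0 (8 `^ _) E8 (2 `^ l) E2
  (_ ^+ (s * p)) G0 (4 ^+ (s * p)) F0.
move=> X X0 S S0 P P0 Q Q0 E E0 T T0 G G0 F F0 H.
have -> : 1 / (S * (T * 2) * E * P * (F * G)) / X =
  (S * P * F)^-1 * (2 * (T * E * X * G))^-1 by field; rewrite ?gt_eqF.
have -> : (S * P)^-1 / Q / F / 3 = (S * P * F)^-1 * (3 * Q)^-1.
  by field; rewrite ?gt_eqF.
by rewrite ler_pM2l ?invr_gt0 ?mulr_gt0 // lef_pV2 ?posrE ?mulr_gt0.
Qed.

Lemma width_bound_L1 (l : R) (s n d q : nat) (p := (Num.truncn l).+1) :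
  0 < l -> (0 < s)%N -> (0 < q)%N ->
  1 <= n%:R * log2 d%:R :> R ->
  q%:R <= 2 * (16 * (n%:R * log2 d%:R)) `^ (s%:R^-1) :> R ->
  width_bound (C_L1 l s) l s n d <=
  (Num.sqrt s%:R * p%:R ^+ p)^-1 / q%:R `^ l *
    ((p`! ^ 2)%:R / (2 * p + 1)`!%:R) ^+ s / 30.
Proof.
move=> l0 s0 q0 X1 qX; rewrite /width_bound /C_L1 -/p.
have := grid_power s0 X1 l0 qX; rewrite -/p.
have qR : 0 < q%:R :> R by rewrite ltr0n.
have ls0 : 0 <= l / s%:R by rewrite divr_ge0 // ltW.
have X0 : 0 < (n%:R * log2 d%:R) `^ (l / s%:R) :> R by rewrite powR_gt0; lra.
have sR : 0 < Num.sqrt s%:R :> R by rewrite sqrtr_gt0 ltr0n.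
have pR : 0 < p%:R ^+ p :> R by rewrite exprn_gt0 // ltr0n.
have ql0 : 0 < q%:R `^ l by rewrite powR_gt0.
have E8 : 0 < 8 `^ (l / s%:R) :> R by rewrite powR_gt0.
have E18 : 8 `^ (l / s%:R) <= 18 `^ (l / s%:R) :> R.
  by rewrite ge0_ler_powR ?nnegrE //; lra.
have E2 : 0 < 2 `^ l :> R by rewrite powR_gt0.
have -> : 2 `^ (l + 2) = 2 `^ l * 4 :> R.
  rewrite powRD ?powR_mulrn //; first by rewrite -natrX.
  by apply/implyP.
have G0 : 0 < (1 + expR 1) ^+ (s * p) :> R.
  by rewrite exprn_gt0 // addr_gt0 ?expR_gt0.
have -> : (2 * Num.truncn l + 3 = 2 * p + 1)%N by rewrite /p; lia.
have F0 : 0 < (2 * p + 1)`!%:R ^+ s :> R by rewrite exprn_gt0 // ltr0n fact_gt0.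
have f0 : 0 < p`!%:R ^+ (2 * s) :> R by rewrite exprn_gt0 // ltr0n fact_gt0.
rewrite expr_div_n natrX -exprM.
move: (_ `^ _) X0 (Num.sqrt _) sR (p%:R ^+ p) pR (q%:R `^ l) ql0 (8 `^ _) E8 (18 `^ _) E18
  (2 `^ l) E2 (_ ^+ (s * p)) G0 (_ ^+ s) F0 (_ ^+ (2 * s)) f0.
move=> X X0 S S0 P P0 Q Q0 E E0 E' EE' T T0 G G0 F F0 f f0 H.
have E'0 : 0 < E' by exact: lt_le_trans EE'.
have -> : f / (5 * S * (T * 4) * E' * P * F * G) / X =
  (S * P * F)^-1 * f * (20 * (T * E' * X * G))^-1 by field; rewrite ?gt_eqF.
have -> : (S * P)^-1 / Q * (f / F) / 30 = (S * P * F)^-1 * f * (30 * Q)^-1.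
  by field; rewrite ?gt_eqF.
rewrite ler_pM2l ?mulr_gt0 ?invr_gt0 ?mulr_gt0 // lef_pV2 ?posrE ?mulr_gt0 //.
apply: (@le_trans _ _ (20 * (T * E * X * G))); first lra.
rewrite ler_pM2l // -!mulrA ler_pM2l // ler_wpM2r //.
by rewrite ltW // mulr_gt0.
Qed.

End constants.

Lemma poly_width_ge (R : realType) (s n d : nat) (L : set ('rV[R]_s -> R))
    (nrm : ('rV[R]_s -> R) -> \bar R) (H : set ('rV[R]_s -> R)) (eps : \bar R) :
  (forall P, poly_maps L n d P ->
    exists2 h, H h & forall zeta : 'rV[R]_n, (eps <= nrm (h \- P zeta)%R)%E) ->
  (eps <= poly_width L nrm n d H)%E.
Proof.
move=> hP; apply: le_ereal_inf_tmp => _ [P PL <-].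
have [h Hh hz] := hP _ PL.
apply: (@le_trans _ _ (ereal_inf [set nrm (h \- P zeta)%R | zeta in [set: 'rV[R]_n]])).
  by apply: le_ereal_inf_tmp => _ [z _ <-].
by apply: ereal_sup_ubound; exists h.
Qed.

(** * The width of the smoothness class *)

Theorem mainTheorem1 (R : realType) (l : R) (s n d : nat) :
  0 < l -> (1 <= s)%N -> (1 <= n)%N -> (2 <= d)%N ->
  let eps_inf := width_bound (C_inf l s) l s n d in
  let eps_L1 := width_bound (C_L1 l s) l s n d in
  ((forall P, poly_maps (continuous_space R s) n d P ->
      exists2 h, Lambda l s h &
        forall zeta : 'rV[R]_n, (eps_inf%:E <= sup_norm (h \- P zeta)%R)%E) /\
   (eps_inf%:E <= poly_width (continuous_space R s) (@sup_norm R s) n d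
                    (Lambda l s))%E) /\
  ((forall P, poly_maps (L1_space R s) n d P ->
      exists2 h, Lambda l s h &
        forall zeta : 'rV[R]_n, (eps_L1%:E <= L1_norm (h \- P zeta)%R)%E) /\
   (eps_L1%:E <= poly_width (L1_space R s) (@L1_norm R s) n d
                   (Lambda l s))%E).
Proof.
move=> l0 s1 n1 d2 eps_inf eps_L1.
have X1 : 1 <= n%:R * log2 d%:R :> R.
  have ln20 : 0 < ln 2 :> R by apply: lt_le_trans ln2_ge; lra.
  apply: mulr_ege1; first by rewrite ler1n.
  by rewrite /log2 ler_pdivlMr // mul1r ler_ln ?posrE ?ltr0n ?ler_nat // ltnW.
have [q [q0 grid qX]] := grid_size s1 X1.
pose p := (Num.truncn l).+1.
pose A : R := (Num.sqrt s%:R * p%:R ^+ p)^-1 / q%:R `^ l.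
have A0 : 0 < A.
  by rewrite divr_gt0 ?invr_gt0 ?mulr_gt0 ?exprn_gt0 ?powR_gt0 ?sqrtr_gt0 ?ltr0n.
have Hinf P : poly_maps (continuous_space R s) n d P -> exists2 h, Lambda l s h &
    forall zeta : 'rV[R]_n, (eps_inf%:E <= sup_norm (h \- P zeta)%R)%E.
  move=> PL; have [sg sgP] := sup_norm_lower (p := p) n1 d2 isT q0 grid A0 PL.
  exists (fun x => A * wave p sg (fun=> 0%N) x); first exact: wave_Lambda.
  move=> zeta; apply: le_trans (sgP zeta).
  by rewrite lee_fin; exact: width_bound_inf.
have HL1 P : poly_maps (L1_space R s) n d P -> exists2 h, Lambda l s h &
    forall zeta : 'rV[R]_n, (eps_L1%:E <= L1_norm (h \- P zeta)%R)%E.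
  move=> PL; have [sg sgP] := L1_norm_lower (p := p) n1 d2 isT q0 grid A0 PL.
  exists (fun x => A * wave p sg (fun=> 0%N) x); first exact: wave_Lambda.
  move=> zeta; apply: le_trans (sgP zeta).
  by rewrite lee_fin; exact: width_bound_L1.
by split; split=> //; exact: poly_width_ge.
Qed.
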